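(* Suppose there exist a diagonal positive definite matrix $Q\in\mathbb{R}^{n\times n}$, a diagonal positive definite matrix $S\in\mathbb{R}^{m\times m}$, a symmetric positive definite matrix $\widehat\Gamma\in\mathbb{R}^{n\times n}$, scalars $\mu,\alpha>0$, and $W\in\mathbb{R}^{m\times n}$ such that $$\begin{pmatrix}-Q\Lambda^{-1} & HQ+BW & BS\\ (HQ+BW)^\top & -e^{-\mu}\Lambda Q & -W^\top\\ (BS)^\top & -W & -2S\end{pmatrix}\le 0,$$ $$\begin{pmatrix}\widehat\Gamma & N\\ N^\top & I\end{pmatrix}\ge 0,\qquad Q(\alpha I-\mu\Lambda)+\widehat\Gamma\le 0 .$$ Let $K:=WQ^{-1}$. Then, for every mild solution pair $(X,d)$ of the closed-loop system $\dot X=\mathcal{A}X+\mathcal{N}d$ (with this gain $K$) with initial condition $X(0)=X_0$, and for all $t\in\mathrm{dom}\,X$, $$\|X(t)\|_{\mathcal{L}^2(0,1;\mathbb{R}^n)}\le\kappa e^{-\omega t}\|X_0\|_{\mathcal{L}^2(0,1;\mathbb{R}^n)}+\gamma\sqrt{\int_0^t\|d(\theta)\|^2_{\mathcal{L}^2(0,1;\mathbb{R}^q)}\,d\theta},$$ with, setting $P:=Q^{-1}$, $$\omega=\frac{\alpha}{2},\qquad \kappa=\sqrt{\frac{\lambda_{\max}(P)}{\lambda_{\min}(P)}}\,e^{\mu/2},\qquad \gamma=\sqrt{\lambda_{\max}(Q)}\,e^{\mu/2}.$$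
   Context: Data: $\Lambda\in\mathbb{R}^{n\times n}$ is diagonal positive definite, $H\in\mathbb{R}^{n\times n}$, $B\in\mathbb{R}^{n\times m}$, $N\in\mathbb{R}^{n\times q}$. For symmetric matrices, $\ge 0$ and $\le 0$ mean positive and negative semidefinite; $\lambda_{\max},\lambda_{\min}$ denote the largest and smallest eigenvalues. For a gain $K\in\mathbb{R}^{m\times n}$, $H_{cl}:=H+BK$. Saturation levels $\overline u_1,\dots,\overline u_m>0$ are given; $\sigma:\mathbb{R}^m\to\mathbb{R}^m$ is defined by $\sigma(u)_i=\min(|u_i|,\overline u_i)\,\mathrm{sign}(u_i)$, and $\phi(u):=\sigma(u)-u$. Operators: $\mathcal{A}X:=-\Lambda X_z$ with domain $\mathcal{D}(\mathcal{A}):=\{X\in\mathcal{H}^1(0,1;\mathbb{R}^n):\ X(0)=H_{cl}X(1)+B\phi(KX(1))\}$; $\mathcal{N}:\mathcal{L}^2(0,1;\mathbb{R}^q)\to\mathcal{L}^2(0,1;\mathbb{R}^n)$, $(\mathcal{N}d)(z)=Nd(z)$. $\epsilon$-approximate solution on $[0,T]$, for $\epsilon>0$ and $f:=\mathcal{N}d\in\mathcal{L}^1(0,T;\mathcal{L}^2(0,1;\mathbb{R}^n))$: choose a partition $0=t_0<t_1<\dots<t_M\le T$ with $t_i-t_{i-1}<\epsilon$ for all $i$ and $T-\epsilon<t_M\le T$, and elements $f_1,\dots,f_M\in\mathcal{L}^2(0,1;\mathbb{R}^n)$ with $\sum_{i=1}^M\int_{t_{i-1}}^{t_i}\|f(s)-f_i\|\,ds<\epsilon$.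 An $\epsilon$-approximate solution with initial condition $X_0$ is a piecewise constant function $w:[0,t_M]\to\mathcal{L}^2(0,1;\mathbb{R}^n)$ with $w(0)=w_0$, $w=w_i$ on $(t_{i-1},t_i]$, where $w_i\in\mathcal{D}(\mathcal{A})$ and $\frac{w_i-w_{i-1}}{t_i-t_{i-1}}=\mathcal{A}w_i+f_i$ for $i=1,\dots,M$, and $\|w_0-X_0\|\le\epsilon$. Mild solution pair: a pair $(X,d)$ with $\mathrm{dom}\,X=\mathrm{dom}\,d=I$, where $I$ is $[0,T]$ ($T>0$) or $[0,\infty)$, $X\in\mathcal{C}(I;\mathcal{L}^2(0,1;\mathbb{R}^n))$, $d\in\mathcal{L}^1(I;\mathcal{L}^2(0,1;\mathbb{R}^q))$, $X(0)=X_0\in\mathcal{L}^2(0,1;\mathbb{R}^n)$, such that for each $\epsilon>0$ there is an $\epsilon$-approximate solution $w$ of $\dot X=\mathcal{A}X+\mathcal{N}d$ with $\|X(t)-w(t)\|\le\epsilon$ for all $t$ in the domain of $w$ (when $I=[0,\infty)$, this is required of the restriction of $(X,d)$ to $[0,T]$, for every $T>0$). The integral $\int_0^t\|d(\theta)\|^2d\theta$ is taken in $[0,\infty]$, the bound being vacuous when it is infinite. *)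

(* Defs.v *)
From HB Require Import structures.
From mathcomp Require Import all_boot all_order all_algebra.
From mathcomp Require Import all_classical all_reals all_analysis.

Set Implicit Arguments.
Unset Strict Implicit.
Unset Printing Implicit Defensive.
Import Order.TTheory GRing.Theory Num.Theory.
Import numFieldNormedType.Exports.
Local Open Scope classical_set_scope.
Local Open Scope ring_scope.

Section matrices.
Context {R : realType} {k : nat}.
Implicit Types M : 'M[R]_k.

Definition possemidef M :=
  M^T = M /\ forall x : 'cV[R]_k, 0 <= (x^T *m M *m x) 0 0.

Definition negsemidef M := possemidef (- M).

Definition posdef M :=
  M^T = M /\ forall x : 'cV[R]_k, x != 0 -> 0 < (x^T *m M *m x) 0 0.

(* The real spectrum is finite, and nonempty for symmetric M (k > 0), so that
   sup and inf are then a maximum and a minimum. *)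
Definition lambda_max M : R := sup [set a | eigenvalue M a].
Definition lambda_min M : R := inf [set a | eigenvalue M a].

End matrices.

Section saturation.
Context {R : realType} {m : nat}.
Variable ubar : 'I_m -> R.

Definition saturation (u : 'cV[R]_m) : 'cV[R]_m :=
  \col_i (Num.min `|u i 0| (ubar i) * Num.sg (u i 0)).

Definition deadzone (u : 'cV[R]_m) : 'cV[R]_m := saturation u - u.

End saturation.

(* Elements of L^2(0,1;R^k) are represented by functions R -> 'cV[R]_k, of
   which only the values on ]0, 1[ matter; equality in L^2 is equality almost
   everywhere on ]0, 1[. *)
Section L2_space.
Context {R : realType} {k : nat}.
Let mu := @lebesgue_measure R.
Implicit Types f g : R -> 'cV[R]_k.

Definition in_L2 f :=
  forall i, (fun z => f z i 0) \_ `]0, 1[%classic \in Lfun mu 2%:E.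

(* The norm of R^k is Euclidean (the library's norm on matrices is the maximum
   norm). *)
Definition L2norm f : R :=
  Num.sqrt (\int[mu]_(z in `]0, 1[) \sum_(i < k) (f z i 0) ^+ 2).

Definition L2eq f g := f = g %[ae mu in `]0, 1[%classic].

Definition test_function (phi : R -> R) :=
  [/\ forall z, derivable phi z 1,
      continuous (derive1 phi) &
      exists a b, [/\ 0 < a, b < 1 &
        forall z, ~~ (a <= z <= b) -> phi z = 0]].

Definition is_weak_derivative f g := forall i phi, test_function phi ->
  \int[mu]_(z in `]0, 1[) (f z i 0 * derive1 phi z) =
  - \int[mu]_(z in `]0, 1[) (g z i 0 * phi z).

Definition in_H1 f :=
  in_L2 f /\ exists g, in_L2 g /\ is_weak_derivative f g.

(* f_z for f in H^1, unique up to L2eq *)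
Definition weak_derivative f : R -> 'cV[R]_k :=
  xget (0 : R -> 'cV[R]_k) [set g | in_L2 g /\ is_weak_derivative f g].

(* The boundary values f(0) and f(1) of f in H^1 are those of its continuous
   representative on [0, 1]. *)
Definition continuous_representative f g :=
  {within `[0, 1], continuous g} /\ L2eq g f.

End L2_space.

(* Functions of time with values in L^2(0,1;R^k), on a time set I *)
Section L2_valued.
Context {R : realType} {k : nat}.
Let mu := @lebesgue_measure R.
Implicit Types (I : set R) (X s : R -> R -> 'cV[R]_k).

Definition L2_continuous I X :=
  (forall t, I t -> in_L2 (X t)) /\
  (forall t, I t -> L2norm (X s - X t) @[s --> within I (nbhs t)] --> 0).

Definition L2_simple s :=
  exists p (A : 'I_p -> set R) (v : 'I_p -> R -> 'cV[R]_k),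
    [/\ forall j, measurable (A j), forall j, in_L2 (v j) &
        forall t, s t = \sum_(j < p) \1_(A j) t *: v j].

Definition L2_strongly_measurable I X :=
  exists s : nat -> R -> R -> 'cV[R]_k, (forall j, L2_simple (s j)) /\
    \forall t \ae mu, I t -> L2norm (s j t - X t) @[j --> \oo] --> 0.

(* L^1(I;L^2(0,1;R^k)) in the sense of Bochner *)
Definition in_L1L2 I X :=
  [/\ forall t, I t -> in_L2 (X t),
      L2_strongly_measurable I X &
      (\int[mu]_(t in I) (L2norm (X t))%:E < +oo)%E].

End L2_valued.

Section closed_loop.
Context {R : realType} {n m q : nat}.
Let mu := @lebesgue_measure R.
Variables (Lambda H : 'M[R]_n) (B : 'M[R]_(n, m)) (N : 'M[R]_(n, q)).
Variables (ubar : 'I_m -> R) (K : 'M[R]_(m, n)).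

Definition Hcl : 'M[R]_n := H + B *m K.

Definition opA (X : R -> 'cV[R]_n) : R -> 'cV[R]_n :=
  fun z => - (Lambda *m weak_derivative X z).

Definition domA (X : R -> 'cV[R]_n) :=
  in_H1 X /\
  exists2 Y, continuous_representative X Y &
    Y 0 = Hcl *m Y 1 + B *m deadzone ubar (K *m Y 1).

Definition opN (d : R -> 'cV[R]_q) : R -> 'cV[R]_n := fun z => N *m d z.

(* w : [0, ts M] -> L^2 is the eps-approximate solution on [0, T] of
   X' = A X + f with initial condition X0 that is built on the partition
   ts 0 < ... < ts M, the elements fs 1, ..., fs M and the values
   ws 0, ..., ws M; other values of ts, fs, ws and w are irrelevant. *)
Record approximate_solution_on (eps T : R) (f : R -> R -> 'cV[R]_n)
    (X0 : R -> 'cV[R]_n) (M : nat) (ts : nat -> R)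
    (fs ws : nat -> R -> 'cV[R]_n) (w : R -> R -> 'cV[R]_n) : Prop := {
  approx_size : (0 < M)%N ;
  approx_start : ts 0%N = 0 ;
  approx_step : forall i, (1 <= i <= M)%N -> 0 < ts i - ts i.-1 < eps ;
  approx_end : T - eps < ts M <= T ;
  approx_source : forall i, (1 <= i <= M)%N -> in_L2 (fs i) ;
  approx_error : (\sum_(1 <= i < M.+1)
    \int[mu]_(s in `[ts i.-1, ts i]) (L2norm (f s - fs i))%:E < eps%:E)%E ;
  approx_w0 : w 0 = ws 0%N ;
  approx_w : forall i s, (1 <= i <= M)%N -> ts i.-1 < s <= ts i -> w s = ws i ;
  approx_L2 : in_L2 (ws 0%N) ;
  approx_dom : forall i, (1 <= i <= M)%N -> domA (ws i) ;
  approx_eq : forall i, (1 <= i <= M)%N ->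
    L2eq ((ts i - ts i.-1)^-1 *: (ws i - ws i.-1)) (opA (ws i) + fs i) ;
  approx_init : L2norm (ws 0%N - X0) <= eps
}.

Definition approximate_solution (eps T : R) (f : R -> R -> 'cV[R]_n)
    (X0 : R -> 'cV[R]_n) (tM : R) (w : R -> R -> 'cV[R]_n) :=
  exists M ts fs ws,
    ts M = tM /\ approximate_solution_on eps T f X0 M ts fs ws w.

Definition mild_on (T : R) (X : R -> R -> 'cV[R]_n) (d : R -> R -> 'cV[R]_q)
    (X0 : R -> 'cV[R]_n) :=
  forall eps, 0 < eps -> exists tM w,
    approximate_solution eps T (fun s => opN (d s)) X0 tM w /\
    forall t, 0 <= t <= tM -> L2norm (X t - w t) <= eps.

Definition mild_solution_pair (I : set R) (X : R -> R -> 'cV[R]_n)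
    (d : R -> R -> 'cV[R]_q) (X0 : R -> 'cV[R]_n) :=
  [/\ L2_continuous I X, in_L1L2 I d, in_L2 X0, L2eq (X 0) X0 &
      (exists T, [/\ 0 < T, I = `[0, T]%classic & mild_on T X d X0]) \/
      (I = `[0, +oo[%classic /\ forall T, 0 < T -> mild_on T X d X0)].

End closed_loop.

(* Main.v *)
Require Import Defs.
From mathcomp Require Import all_boot all_order all_algebra.
From mathcomp Require Import all_classical all_reals all_analysis measurable_realfun.
From mathcomp Require Import ring lra.
Set Implicit Arguments.
Unset Strict Implicit.
Unset Printing Implicit Defensive.
Import Order.TTheory GRing.Theory Num.Theory.
Import numFieldNormedType.Exports.
Local Open Scope classical_set_scope.
Local Open Scope ring_scope.

(** The proof is a Lyapunov argument for the functional V(X), the integral over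
    ]0, 1[ of e^(-mu z) X(z)^T P X(z) with P the inverse of Q. A formal
    computation along dX/dt = - Lambda X_z + N d gives, writing <.,.> for the
    inner product of V,
      dV/dt = 2 <X, - Lambda X_z> + 2 <X, N d>.
    Integrating the first term by parts leaves
      X(0)^T P Lambda X(0) - e^(-mu) X(1)^T P Lambda X(1)
    and - mu times the integral of e^(-mu z) X^T P Lambda X. The first matrix
    inequality, tested on (Lambda P X(0), P X(1), S^-1 phi) where phi is the
    deadzone of K X(1), bounds the boundary term by 2 phi^T S^-1 (phi + K X(1)),
    which is nonpositive because the saturation is a sector nonlinearity
    ([boundary_dissipation]). The other two inequalities, tested on (P X, - d)
    and on P X, say that
      2 X^T P N d <= mu X^T P Lambda X - alpha X^T P X + |d|^2
    ([supply_rate]). Altogether 2 <X, A X + N d> <= - alpha V(X) + |d|^2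
    ([energy_dissipation]).

    A mild solution is a limit of implicit Euler schemes, so time is never
    differentiated: V is convex, hence
      V(w_i) - V(w_(i-1)) <= 2 <w_i, w_i - w_(i-1)>,
    and the right-hand side is twice the step size times <w_i, A w_i + f_i>.
    The sources f_i approximate N d only in L^1 in time, whereas |d|^2 has to
    appear. The dissipation inequality is therefore applied with y = d(s) for
    each s in the step, at the price of 2 <w_i, f_i - N d(s)>, and then
    integrated over s. As X is bounded on bounded time intervals, so are the
    w_i, and these errors sum up to O(eps) ([approximate_energy]). A discrete
    Gronwall inequality and the limit eps -> 0 yield
      V(X(t)) <= e^(-alpha t) V(X0) + the integral of |d|^2 over [0, t]
    ([mild_energy]). Comparing V with the L^2 norm, with weights between
    lambda_min(P) e^(-mu) and lambda_max(P), gives the constants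
    ([gain_estimate]).

    The integration by parts concerns functions whose weak derivative is defined
    by C^1 test functions only. An inequality suffices, in the direction
    that makes the difference quotient of U times U comparable with that of
    U^2 / 2. So no density theorem or absolute continuity enters: difference
    quotients of a primitive of U, cut off near the boundary, are legitimate
    test functions ([energy_inequality]).

    The function |d(s)| is only almost everywhere equal to a Borel function, and
    the integral of a nonnegative function that is not Borel measurable is the
    supremum of the integrals of the simple functions below it. Such lower
    integrals are monotone but not additive. Each estimate is therefore done
    with a Borel minorant F of |d| that equals |d| almost everywhere
    ([strongly_measurable_L2norm], [le_interval_lower_integral]). *)

(** * Integration over the unit interval *)

Section unit_interval.
Context {R : realType}.
Implicit Types (u v k : R -> R).

Definition int01 u : R := \int[@lebesgue_measure R]_(z in `]0, 1[) u z.

Definition integrable01 u :=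
  (@lebesgue_measure R).-integrable `]0, 1[ (EFin \o u).

(** The components of an element of [in_L2] are of this form. *)
Definition L2scalar u := u \_ `]0, 1[%classic \in Lfun (@lebesgue_measure R) 2%:E.

Let m01 : measurable (`]0, 1[%classic : set (measurableTypeR R)).
Proof. exact: measurable_itv. Qed.

Lemma eq_int01 u v : (forall z, 0 < z < 1 -> u z = v z) -> int01 u = int01 v.
Proof.
by move=> uv; apply: eq_Rintegral => z; rewrite inE /= in_itv/= => /uv.
Qed.

Lemma eq_integrable01 u v : (forall z, 0 < z < 1 -> u z = v z) ->
  integrable01 u -> integrable01 v.
Proof.
move=> uv iu; apply: (eq_integrable m01 _ _ _ iu) => z.
by rewrite inE /= in_itv/= => /uv ->.
Qed.

Lemma integrable01D u v : integrable01 u -> integrable01 v ->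
  integrable01 (fun z => u z + v z).
Proof. by move=> iu iv; exact: eq_integrable01 (integrableD m01 iu iv). Qed.

Lemma integrable01Z (c : R) u : integrable01 u -> integrable01 (fun z => c * u z).
Proof. by move=> iu; exact: eq_integrable01 (integrableZl m01 c iu). Qed.

Lemma integrable01N u : integrable01 u -> integrable01 (fun z => - u z).
Proof.
move=> /(integrable01Z (-1)); apply: eq_integrable01 => z _ /=.
by rewrite mulN1r.
Qed.

Lemma integrable01B u v : integrable01 u -> integrable01 v ->
  integrable01 (fun z => u z - v z).
Proof. by move=> iu iv; apply: integrable01D => //; exact: integrable01N. Qed.

Lemma int01D u v : integrable01 u -> integrable01 v ->
  int01 (fun z => u z + v z) = int01 u + int01 v.
Proof. by move=> iu iv; exact: RintegralD. Qed.

Lemma int01Z (c : R) u : integrable01 u -> int01 (fun z => c * u z) = c * int01 u.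
Proof. by move=> iu; exact: RintegralZl. Qed.

Lemma int01B u v : integrable01 u -> integrable01 v ->
  int01 (fun z => u z - v z) = int01 u - int01 v.
Proof. by move=> iu iv; exact: RintegralB. Qed.

Lemma integrable01_sum (I : finType) (u : I -> R -> R) :
  (forall i, integrable01 (u i)) -> integrable01 (fun z => \sum_i u i z).
Proof.
move=> iu; rewrite /integrable01.
have -> : EFin \o (fun z => \sum_i u i z) = (fun z => \sum_i (u i z)%:E)%E.
  by apply/funext => z /=; rewrite sumEFin.
by apply: (integrable_sum m01) => i _; exact: iu.
Qed.

Lemma int01_sum (I : finType) (u : I -> R -> R) :
  (forall i, integrable01 (u i)) ->
  int01 (fun z => \sum_i u i z) = \sum_i int01 (u i).
Proof.
move=> iu; suff H (s : seq I) : integrable01 (fun z => \sum_(i <- s) u i z) /\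
    int01 (fun z => \sum_(i <- s) u i z) = \sum_(i <- s) int01 (u i).
  exact: (H _).2.
have i0 : integrable01 (fun=> 0).
  by apply: eq_integrable01 (integrable0 _ _).
elim: s => [|i s [IH1 IH2]].
  split.
    by apply: eq_integrable01 i0 => // z _ /=; rewrite big_nil.
  rewrite big_nil; transitivity (int01 (fun=> 0)).
    by apply: eq_int01 => z _; rewrite big_nil.
  by rewrite /int01 Rintegral_cst//= mul0r.
split.
  apply: eq_integrable01 (integrable01D (iu i) IH1) => // z _ /=.
  by rewrite big_cons.
rewrite big_cons -IH2 -int01D//.
by apply: eq_int01 => z _; rewrite big_cons.
Qed.

Lemma le_int01 u v : integrable01 u -> integrable01 v ->
  (forall z, 0 < z < 1 -> u z <= v z) -> int01 u <= int01 v.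
Proof.
move=> iu iv uv; apply: (le_Rintegral m01 iu iv) => z.
by rewrite /= in_itv/=; exact: uv.
Qed.

Lemma int01_ge0 u : (forall z, 0 < z < 1 -> 0 <= u z) -> 0 <= int01 u.
Proof.
by move=> u0; apply: Rintegral_ge0 => z; rewrite /= in_itv/=; exact: u0.
Qed.

Lemma eq_int01_ae u v : integrable01 u -> integrable01 v ->
  u = v %[ae @lebesgue_measure R in `]0, 1[%classic] -> int01 u = int01 v.
Proof.
move=> iu iv uv; rewrite /int01 /Rintegral; congr fine.
apply: ae_eq_integral => //.
- by case/integrableP : iu.
- by case/integrableP : iv.
- by move: uv; apply: (@filterS _ _ (ae_filter_ringOfSetsType _)) => z /= uvz Dz; rewrite uvz.
Qed.

Lemma continuous_bounded01 k : continuous k ->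
  exists2 M, 0 <= M & forall z, 0 <= z <= 1 -> `|k z| <= M.
Proof.
move=> ck.
have cn : {within `[0, 1], continuous (fun z => `|k z|)}.
  by apply: continuous_subspaceT => z; apply: continuous_comp;
    [exact: ck|exact: norm_continuous].
have [c c01 cmax] := EVT_max (@ler01 R) cn.
by exists `|k c| => // z z01; apply: cmax; rewrite in_itv.
Qed.

Lemma continuous_bounded_near01 k : continuous k -> [bounded k z | z in `]0, 1[].
Proof.
move=> /continuous_bounded01[M M0 kM]; exists M; split; first exact: num_real.
move=> x Mx z /=; rewrite in_itv/= => /andP[z0 z1].
by rewrite (le_trans _ (ltW Mx))// kM// !ltW.
Qed.

Lemma continuous_measurable01 k (D : set (measurableTypeR R)) : continuous k -> measurable D ->
  measurable_fun D k.
Proof.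
by move=> ck mD; apply: measurable_funTS; exact: continuous_measurable_fun.
Qed.

(** A continuous function is bounded on [0, 1], so its product with an integrable one
    is integrable. *)
Lemma integrable01M k u : continuous k -> integrable01 u ->
  integrable01 (fun z => k z * u z).
Proof.
move=> ck iu; apply: (integrableMr m01 _ _ iu).
- exact: continuous_measurable01.
- exact: continuous_bounded_near01.
Qed.

Lemma integrable01_continuous k : continuous k -> integrable01 k.
Proof.
have fin01 : ((@lebesgue_measure R) `]0%R, 1%R[%classic < +oo)%E.
  by rewrite lebesgue_measure_itv/= lte_fin ltr01 -EFinB ltry.
move=> ck; apply: measurable_bounded_integrable => //.
- exact: continuous_measurable01.
- exact: continuous_bounded_near01.
Qed.

Lemma L2scalar_measurable u : L2scalar u ->
  measurable_fun (`]0, 1[%classic : set (measurableTypeR R)) u.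
Proof.
move=> /sub_Lfun_mfun; rewrite inE/= => mu.
by apply/(measurable_restrictT _ _).2.
Qed.

Lemma integrable01_L2 u v : L2scalar u -> L2scalar v ->
  integrable01 (fun z => u z * v z).
Proof.
move=> Lu Lv; have /Lfun1_integrable := Lfun2_mul_Lfun1 Lu Lv.
move=> iuv; apply/integrable_mkcond => //; apply: (eq_integrable measurableT _ _ _ iuv) => // z _.
by rewrite /= /patch; case: ifPn => //=; rewrite mul0r.
Qed.

(** On a set of finite measure this is the bound |u| <= 1 + u^2. *)
Lemma L2scalar_integrable u : L2scalar u -> integrable01 u.
Proof.
move=> Lu.
have i1 : integrable01 (fun z => 1 + u z * u z).
  apply: integrable01D (integrable01_L2 Lu Lu).
  by apply: integrable01_continuous => z; exact: cst_continuous.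
apply: le_integrable i1 => //.
  by apply/measurable_EFinP; exact: L2scalar_measurable.
move=> z _ /=; rewrite lee_fin [leRHS]ger0_norm; last first.
  by rewrite addr_ge0// -expr2 sqr_ge0.
by rewrite ler_norml; apply/andP; split; nra.
Qed.

Let L2_1 : (1 <= 2%:E :> \bar R)%E. Proof. by rewrite lee_fin ler1n. Qed.

Lemma L2scalarD u v : L2scalar u -> L2scalar v -> L2scalar (fun z => u z + v z).
Proof.
move=> Lu Lv; rewrite /L2scalar.
have -> : (fun z => u z + v z) \_ `]0, 1[%classic =
    u \_ `]0, 1[%classic + v \_ `]0, 1[%classic.
  by apply/funext => z; rewrite [RHS]/= /patch fctE; case: ifP => // _; rewrite addr0.
by have [_] := Lfun_addr_closed (@lebesgue_measure R) L2_1; exact.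
Qed.

Lemma L2scalarZ (c : R) u : L2scalar u -> L2scalar (fun z => c * u z).
Proof.
move=> Lu; rewrite /L2scalar.
have -> : (fun z => c * u z) \_ `]0, 1[%classic = c \o* (u \_ `]0, 1[%classic).
  by apply/funext => z; rewrite [RHS]/= /patch; case: ifP => //= _; rewrite ?mul0r// mulrC.
by apply: Lfun_scale; rewrite ?ler1n.
Qed.

Lemma L2scalar0 : L2scalar (fun=> 0).
Proof.
rewrite /L2scalar (_ : _ \_ _ = 0); last first.
  by apply/funext => z; rewrite /patch; case: ifP.
by have [] := Lfun_addr_closed (@lebesgue_measure R) L2_1.
Qed.

Lemma L2scalar_sum (I : finType) (u : I -> R -> R) :
  (forall i, L2scalar (u i)) -> L2scalar (fun z => \sum_i u i z).
Proof.
move=> Lu; suff H (s : seq I) : L2scalar (fun z => \sum_(i <- s) u i z) by exact: H.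
elim: s => [|i s IH].
  by under eq_fun do rewrite big_nil; exact: L2scalar0.
by under eq_fun do rewrite big_cons; exact: L2scalarD.
Qed.

End unit_interval.

(** * Primitives and difference quotients *)

Section calculus.
Context {R : realType}.
Implicit Types (f g u v k : R -> R).

Lemma derive_continuous f (f' : R -> R) :
  (forall z : R, is_derive z 1 f (f' z)) -> continuous f.
Proof.
move=> df z; apply: differentiable_continuous.
by apply/derivable1_diffP; case: (df z).
Qed.

Lemma derive1_eq f (f' : R -> R) : (forall z : R, is_derive z 1 f (f' z)) -> derive1 f = f'.
Proof. by move=> df; apply/funext => z; rewrite derive1E; apply: derive_val. Qed.

Lemma MVT_everywhere f (f' : R -> R) (a b : R) : (forall z : R, is_derive z 1 f (f' z)) ->
  a < b -> exists c, a < c < b /\ f b - f a = f' c * (b - a).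
Proof.
move=> df ab; have [|c] := MVT ab (fun z _ => df z).
  by apply: continuous_subspaceT; exact: derive_continuous df.
by rewrite in_itv/= => cab ->; exists c.
Qed.

Lemma int01_FTC f (f' : R -> R) : (forall z : R, is_derive z 1 f (f' z)) -> continuous f' ->
  int01 f' = f 1 - f 0.
Proof.
move=> df cf'; have if' := integrable01_continuous cf'.
have cf := derive_continuous df.
have i01 : (@lebesgue_measure R).-integrable `]0, 1] (EFin \o f').
  apply: integrableS (continuous_compact_integrable (@segment_compact R 0 1) _) => //.
  - exact: subset_itv_oc_cc.
  - exact: continuous_subspaceT.
rewrite /int01 Rintegral_itv_bndo_bndc// Rintegral_itv_obnd_cbnd//.
rewrite /Rintegral (@continuous_FTC2 R f' f)//.
- exact: continuous_subspaceT.
- split.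
  + by move=> z _; case: (df z).
  + exact/cvg_at_right_filter/cf.
  + exact/cvg_at_left_filter/cf.
- by move=> z _; rewrite (derive1_eq df).
Qed.

(** Subtracting the constant [u 0] leaves a function that is integrable on every left
    half-line, whose integral from minus infinity is differentiable everywhere; this
    is what the hypothesis on negative arguments is for. *)
Lemma primitive_exists u : continuous u -> (forall z, z <= 0 -> u z = u 0) ->
  exists F, forall z : R, is_derive z 1 F (u z).
Proof.
move=> cu u0; pose v z := u z - u 0.
have cv : continuous v.
  by move=> z; apply: continuousB; [exact: cu|exact: cst_continuous].
have iv y : (@lebesgue_measure R).-integrable `]-oo, y] (EFin \o v).
  have i0 : (@lebesgue_measure R).-integrable `[0, y] (EFin \o v).
    apply: continuous_compact_integrable; first exact: segment_compact.
    exact: continuous_subspaceT.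
  have : (@lebesgue_measure R).-integrable `]-oo, y] ((EFin \o v) \_ `[0, y]).
    apply/integrable_restrict => //; rewrite setIidr//.
    by move=> z /=; rewrite !in_itv/= => /andP[].
  apply: eq_integrable => // z; rewrite inE/= in_itv/= => zy.
  rewrite patchE; case: ifPn => //; rewrite notin_setE/= in_itv/= zy andbT => /negP.
  by rewrite -ltNge => /ltW/u0; rewrite /v => ->; rewrite subrr.
pose G x := \int[@lebesgue_measure R]_(t in `]-oo, x]) v t.
exists (fun x => G x + u 0 * x).
have dG (z : R) : is_derive z 1 G (v z).
  have [||dG <-] := @continuous_FTC1 R v -oo%O z (z + 1) _ (iv _) _ (cv z).
  - by rewrite ltrDl.
  - by rewrite ltNyr.
  - by rewrite derive1E; apply: derivableP.
move=> z; have -> : u z = v z + u 0 * 1 by rewrite /v mulr1 subrK.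
have := is_deriveD (dG z) (is_deriveZ (u 0) (is_derive_id z 1)).
by [].
Qed.

(** Dominated convergence, in the only form in which the limits below arise: a bounded
    sequence of continuous multipliers of a fixed integrable function. *)
Lemma int01_dominated (w : nat -> R -> R) g k (M : R) :
  integrable01 k -> (forall n, continuous (w n)) -> continuous g ->
  (forall z, 0 < z < 1 -> w n z @[n --> \oo] --> g z) ->
  (forall n z, 0 < z < 1 -> `|w n z| <= M) ->
  int01 (fun z => w n z * k z) @[n --> \oo] --> int01 (fun z => g z * k z).
Proof.
move=> ik cw cg wg wM.
have m01 : measurable (`]0, 1[%classic : set (measurableTypeR R)).
  exact: measurable_itv.
have iw n : integrable01 (fun z => w n z * k z) by exact: integrable01M.
have ig : integrable01 (fun z => g z * k z) by exact: integrable01M.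
have : (\int[@lebesgue_measure R]_(z in `]0%R, 1%R[) (w n z * k z)%:E)%E
    @[n --> \oo] --> (int01 (fun z => g z * k z))%:E.
  rewrite /int01 /Rintegral fineK; last exact: integrable_fin_num.
  apply: (@dominated_cvg _ _ _ _ _ m01 _ _ (fun z => (M * `|k z|)%:E)).
  - by move=> n; case/integrableP : (iw n).
  - move=> z; rewrite /= in_itv/= => z01; apply: cvg_EFin.
      by near=> n.
    by apply: cvgMl; exact: wg.
  - by [].
  - exact: (integrable01Z M (integrable_norm ik)).
  - move=> n z; rewrite /= in_itv/= => z01.
    by rewrite lee_fin normrM ler_wpM2r// wM.
by move=> /fine_cvgP[_].
Unshelve. all: by end_near. Qed.

Lemma continuous_addf u v : continuous u -> continuous v ->
  continuous (fun z => u z + v z).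
Proof. by move=> cu cv z; apply: cvgD; [exact: cu|exact: cv]. Qed.

Lemma continuous_mulf u v : continuous u -> continuous v ->
  continuous (fun z => u z * v z).
Proof. by move=> cu cv z; apply: cvgM; [exact: cu|exact: cv]. Qed.

Lemma continuous_affine u (a b : R) : continuous u ->
  continuous (fun z => u (a * z + b)).
Proof.
move=> cu z; apply: (@continuous_comp _ _ _ (fun x : R => a * x + b) u); last exact: cu.
by apply: cvgD; [apply: cvgMr; exact: cvg_id|exact: cvg_cst].
Qed.

Section difference_quotient.
Variables (u F : R -> R).
Hypothesis cu : continuous u.
Hypothesis dF : forall z : R, is_derive z 1 F (u z).

(** When F is a primitive of u, the difference quotient of F is the average of u
    between z and z + h, a C^1 approximation of u whose derivative is the difference quotient
    of u. *)
Definition quotient_step n : R := n.+1%:R^-1.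

Definition difference_quotient n z : R :=
  (F (z + quotient_step n) - F z) * n.+1%:R.

Lemma difference_quotient_derive n (z : R) : is_derive z 1 (difference_quotient n)
  ((u (z + quotient_step n) - u z) * n.+1%:R).
Proof.
have d1 : is_derive z 1 (fun x => F (x + quotient_step n)) (u (z + quotient_step n)).
  have := @is_derive1_comp R F (fun x => x + quotient_step n) z _ 1
    (dF (z + quotient_step n)) (is_derive_shift _ _ _).
  by rewrite mulr1.
have := is_deriveZ n.+1%:R (is_deriveB d1 (dF z)).
suff <- : difference_quotient n =
    n.+1%:R \*: ((fun x : R => F (x + quotient_step n)) - F) by rewrite [in X in _ -> X]mulrC.
by apply/funext => x; rewrite /difference_quotient mulrC.
Qed.

Lemma difference_quotient_mean n z :
  exists c, z < c < z + quotient_step n /\ difference_quotient n z = u c.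
Proof.
have [|c [zc eq]] := MVT_everywhere (b := z + quotient_step n) dF (a := z).
  by rewrite ltrDl invr_gt0.
exists c; split => //; rewrite /difference_quotient eq addrAC subrr add0r -mulrA.
by rewrite mulVf ?mulr1// pnatr_eq0.
Qed.

Lemma difference_quotient_cvg z : difference_quotient n z @[n --> \oo] --> u z.
Proof.
apply/cvgrPdist_lt => e e0.
have /cvgrPdist_lt /(_ e e0) [d /= d0 du] := cu (x := z).
have /cvgrPdist_lt /(_ d d0) : quotient_step n @[n --> \oo] --> (0 : R).
  exact: cvg_harmonic.
apply: filterS => n; rewrite sub0r normrN => hn.
have [c [/andP[zc cz] ->]] := difference_quotient_mean n z.
apply: du; rewrite /ball_/= distrC gtr0_norm ?subr_gt0// ltrBlDl.
apply: (lt_trans cz); rewrite ltrD2l.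
by apply: le_lt_trans hn; exact: ler_norm.
Qed.

Lemma difference_quotient_bounded : exists M, forall n z, 0 < z < 1 ->
  `|difference_quotient n z| <= M.
Proof.
have [c c02 cmax] : exists2 c, c \in `[0, 2] &
    forall t, t \in `[0, 2] -> `|u t| <= `|u c|.
  apply: (EVT_max (f := fun t => `|u t|)); first exact: ler0n.
  by apply: continuous_subspaceT => t; apply: continuous_comp;
    [exact: cu|exact: norm_continuous].
exists `|u c| => n z /andP[z0 z1].
have [x [/andP[zx xz] ->]] := difference_quotient_mean n z.
apply: cmax; rewrite in_itv/= (ltW (lt_trans z0 zx))/= ltW//.
apply: (lt_le_trans xz); rewrite [leRHS](_ : _ = 1 + 1)// lerD ?(ltW z1)//.
by rewrite invf_le1 ?ler1n.
Qed.

End difference_quotient.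

End calculus.

(** * Energy inequality for weak derivatives *)

Section energy_inequality.
Context {R : realType}.
Implicit Types (u v g U psi : R -> R).

(** One component of [is_weak_derivative]. *)
Definition weak_derivative_scalar u g := forall phi, test_function phi ->
  int01 (fun z => u z * derive1 phi z) = - int01 (fun z => g z * phi z).

Lemma test_functionM u (u' : R -> R) psi :
  (forall z : R, is_derive z 1 u (u' z)) -> continuous u' ->
  test_function psi ->
  test_function (fun z => u z * psi z) /\
  derive1 (fun z => u z * psi z) =
    (fun z => u' z * psi z + u z * derive1 psi z).
Proof.
move=> du cu' [dpsi cpsi' [a [b [a0 b1 psi0]]]].
have dpsi' (z : R) : is_derive z 1 psi (derive1 psi z).
  by rewrite derive1E; exact: derivableP.
have dupsi (z : R) : is_derive z 1 (fun z => u z * psi z)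
    (u' z * psi z + u z * derive1 psi z).
  have := is_deriveM (du z) (dpsi' z).
  by rewrite addrC [psi z *: _]mulrC.
have eq := derive1_eq dupsi.
split; last exact: eq.
split.
- by move=> z; case: (dupsi z).
- rewrite eq; apply: continuous_addf; apply: continuous_mulf.
  + exact: cu'.
  + exact: (derive_continuous dpsi').
  + exact: (derive_continuous du).
  + exact: cpsi'.
- by exists a, b; split => // z /psi0 ->; rewrite mulr0.
Qed.

(** Test the weak derivative with phi = f psi, where f is a difference quotient with
    step h of a primitive of U. The derivative of f is (U(z+h) - U(z)) / h, and
    U(z) (U(z+h) - U(z)) <= (U(z+h)^2 - U(z)^2) / 2, so the term with f' is bounded by
    half the derivative s' of the difference quotient s of a primitive of U^2. As psi
    vanishes at both ends, s' psi integrates to - s psi'. Let h -> 0. *)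
Lemma energy_inequality_interior u g U psi :
  L2scalar u -> L2scalar g -> weak_derivative_scalar u g ->
  continuous U -> (forall z, z <= 0 -> U z = U 0) ->
  U = u %[ae @lebesgue_measure R in `]0, 1[%classic] ->
  test_function psi -> (forall z, 0 < z < 1 -> 0 <= psi z) ->
  - (int01 (fun z => U z ^+ 2 * derive1 psi z) / 2) <=
  int01 (fun z => U z * (g z * psi z)).
Proof.
move=> Lu Lg wg cU U0 Uu tpsi psi_ge0.
have cU2 : continuous (fun z => U z ^+ 2).
  by move=> z; apply: continuousM; exact: cU.
have U20 z : z <= 0 -> U z ^+ 2 = U 0 ^+ 2 by move=> /U0 ->.
have [F dF] := primitive_exists cU U0.
have [G dG] := primitive_exists cU2 U20.
have [dpsi cpsi' [a [b [a0 b1 psi0]]]] := tpsi.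
have dpsi' (z : R) : is_derive z 1 psi (derive1 psi z).
  by rewrite derive1E; exact: derivableP.
have cpsi := derive_continuous dpsi'.
have psi_0 : psi 0 = 0 by apply: psi0; rewrite leNgt a0.
have psi_1 : psi 1 = 0 by apply: psi0; rewrite [1 <= b]leNgt b1 andbF.
pose f := difference_quotient F; pose s := difference_quotient G.
pose h n : R := quotient_step n.
pose f' n z := (U (z + h n) - U z) * n.+1%:R.
pose s' n z := (U (z + h n) ^+ 2 - U z ^+ 2) * n.+1%:R.
have df n (z : R) : is_derive z 1 (f n) (f' n z) := difference_quotient_derive dF n z.
have ds n (z : R) : is_derive z 1 (s n) (s' n z) := difference_quotient_derive dG n z.
have cf n := derive_continuous (df n).
have cs n := derive_continuous (ds n).
have cdiff v n : continuous v -> continuous (fun z => (v (z + h n) - v z) * n.+1%:R).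
  move=> cv z; apply: cvgMl; apply: cvgB; last exact: cv.
  suff : continuous (fun x => v (x + h n)) by exact.
  have -> : (fun x => v (x + h n)) = (fun x => v (1 * x + h n)).
    by apply/funext => x; rewrite mul1r.
  exact: continuous_affine.
have cf' n : continuous (f' n) := cdiff _ _ cU.
have cs' n : continuous (s' n) := cdiff _ _ cU2.
have ineq n : - int01 (fun z => f n z * (g z * psi z)) <=
    - (int01 (fun z => s n z * derive1 psi z) / 2) +
    int01 (fun z => f n z * (U z * derive1 psi z)).
  have [tf df_eq] := test_functionM (df n) (cf' n) tpsi.
  have [ts ds_eq] := test_functionM (ds n) (cs' n) tpsi.
  have cfpsi' : continuous (fun z => f' n z * psi z + f n z * derive1 psi z).
    by rewrite -df_eq; case: tf.
  have -> : int01 (fun z => f n z * (g z * psi z)) =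
      int01 (fun z => g z * (f n z * psi z)).
    by apply: eq_int01 => z _; rewrite mulrCA.
  rewrite -wg// df_eq.
  have -> : int01 (fun z => u z * (f' n z * psi z + f n z * derive1 psi z)) =
      int01 (fun z => U z * (f' n z * psi z + f n z * derive1 psi z)).
    apply: eq_int01_ae.
    - apply: (eq_integrable01 _ (integrable01M cfpsi' (L2scalar_integrable Lu))) => z _.
      by rewrite mulrC.
    - by apply: integrable01_continuous; apply: continuous_mulf; [exact: cU|exact: cfpsi'].
    - by move: Uu; apply: (@filterS _ _ (ae_filter_ringOfSetsType _)) => z + Dz => ->.
  (* Integration by parts for the C^1 function s psi, which vanishes at 0 and 1. *)
  have -> : int01 (fun z => s n z * derive1 psi z) = - int01 (fun z => s' n z * psi z).
    have i1 : integrable01 (fun z => s' n z * psi z).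
      by apply: integrable01_continuous; apply: continuous_mulf; [exact: cs'|exact: cpsi].
    have i2 : integrable01 (fun z => s n z * derive1 psi z).
      by apply: integrable01_continuous; apply: continuous_mulf; [exact: cs|exact: cpsi'].
    apply/eqP; rewrite -addr_eq0 addrC -int01D//; apply/eqP.
    have [dts cts' _] := ts.
    have dd (z : R) : is_derive z 1 (fun z => s n z * psi z)
        (derive1 (fun z => s n z * psi z) z).
      by rewrite derive1E; exact: derivableP.
    by rewrite -ds_eq (int01_FTC dd cts') psi_0 psi_1 !mulr0 subrr.
  rewrite mulNr opprK -lerBlDr [leRHS]mulrC -int01Z; last first.
    by apply: integrable01_continuous; apply: continuous_mulf; [exact: cs'|exact: cpsi].
  rewrite -int01B; last 2 first.
  - by apply: integrable01_continuous; apply: continuous_mulf; [exact: cU|exact: cfpsi'].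
  - apply: integrable01_continuous; apply: continuous_mulf; first exact: cf.
    by apply: continuous_mulf; [exact: cU|exact: cpsi'].
  apply: le_int01.
  - apply: integrable01B.
      by apply: integrable01_continuous; apply: continuous_mulf; [exact: cU|exact: cfpsi'].
    apply: integrable01_continuous; apply: continuous_mulf; first exact: cf.
    by apply: continuous_mulf; [exact: cU|exact: cpsi'].
  - apply: integrable01Z.
    by apply: integrable01_continuous; apply: continuous_mulf; [exact: cs'|exact: cpsi].
  - move=> z z01; have := psi_ge0 z z01.
    rewrite /f' /s'; set x := U z; set y := U (z + h n) => p0.
    have -> : x * ((y - x) * n.+1%:R * psi z + f n z * derive1 psi z) -
      f n z * (x * derive1 psi z) = (x * (y - x)) * (n.+1%:R * psi z) by ring.
    have -> : 2^-1 * ((y ^+ 2 - x ^+ 2) * n.+1%:R * psi z) =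
       ((y ^+ 2 - x ^+ 2) / 2) * (n.+1%:R * psi z) by ring.
    rewrite ler_wpM2r ?mulr_ge0//.
    by have := sqr_ge0 (y - x); nra.
have [M1 fM] := difference_quotient_bounded cU dF.
have [M2 sM] := difference_quotient_bounded cU2 dG.
have cv1 : int01 (fun z => f n z * (g z * psi z)) @[n --> \oo] -->
    int01 (fun z => U z * (g z * psi z)).
  apply: (int01_dominated (M := M1)) => //.
    apply: (eq_integrable01 _ (integrable01M cpsi (L2scalar_integrable Lg))) => z _.
    by rewrite mulrC.
  by move=> z _; exact: difference_quotient_cvg.
have cv2 : int01 (fun z => s n z * derive1 psi z) @[n --> \oo] -->
    int01 (fun z => U z ^+ 2 * derive1 psi z).
  apply: (int01_dominated (M := M2)) => //.
    exact: integrable01_continuous.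
  by move=> z _; exact: (difference_quotient_cvg cU2 dG).
have cv3 : int01 (fun z => f n z * (U z * derive1 psi z)) @[n --> \oo] -->
    int01 (fun z => U z * (U z * derive1 psi z)).
  apply: (int01_dominated (M := M1)) => //.
    by apply: integrable01_continuous; apply: continuous_mulf; [exact: cU|exact: cpsi'].
  by move=> z _; exact: difference_quotient_cvg.
have lhs : - int01 (fun z => f n z * (g z * psi z)) @[n --> \oo] -->
    - int01 (fun z => U z * (g z * psi z)) by exact: cvgN.
have rhs : - (int01 (fun z => s n z * derive1 psi z) / 2) +
      int01 (fun z => f n z * (U z * derive1 psi z)) @[n --> \oo] -->
    - (int01 (fun z => U z ^+ 2 * derive1 psi z) / 2) +
      int01 (fun z => U z * (U z * derive1 psi z)).
  by apply: cvgD cv3; apply: cvgN; exact: cvgMl.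
have : - int01 (fun z => U z * (g z * psi z)) <=
    - (int01 (fun z => U z ^+ 2 * derive1 psi z) / 2) +
      int01 (fun z => U z * (U z * derive1 psi z)).
  exact: ler_cvg_to lhs rhs (nearW _ ineq).
have -> : int01 (fun z => U z * (U z * derive1 psi z)) =
    int01 (fun z => U z ^+ 2 * derive1 psi z).
  by apply: eq_int01 => z _; rewrite mulrA.
set A := int01 _; set B := int01 _; lra.
Qed.

(** A normalised primitive of the positive part of z (1 - z). *)
Lemma C1_step_exists : exists theta b : R -> R,
  [/\ forall z : R, is_derive z 1 theta (b z), continuous b,
      forall z, 0 <= b z, forall z, (z <= 0) || (1 <= z) -> b z = 0 &
      (forall z, z <= 0 -> theta z = 0) /\ (forall z, 1 <= z -> theta z = 1)].
Proof.
pose b0 (z : R) := Num.max (z * (1 - z)) 0.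
have cb0 : continuous b0.
  have -> : b0 = (fun z => (z * (1 - z) + `|z * (1 - z)|) / 2).
    by apply/funext => z; rewrite /b0 maxr_absE addr0 subr0.
  have c1 : continuous (fun z : R => z * (1 - z)).
    move=> z; apply: cvgM; first exact: cvg_id.
    by apply: cvgB; [exact: cvg_cst|exact: cvg_id].
  by move=> z; apply: cvgMl; apply: cvgD; [exact: c1|apply: cvg_norm; exact: c1].
have b0_out z : (z <= 0) || (1 <= z) -> b0 z = 0.
  by move=> z01; rewrite /b0 max_r//; case/orP : z01 => ?; nra.
have b0_ge0 z : 0 <= b0 z by rewrite le_max lexx orbT.
have [|F dF] := primitive_exists cb0.
  by move=> z z0; rewrite !b0_out ?z0 ?lexx.
have F_l z : z <= 0 -> F z = F 0.
  rewrite le_eqVlt => /predU1P[->//|z0].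
  have [c [/andP[_ c0]]] := MVT_everywhere dF z0.
  by rewrite b0_out ?(ltW c0)// mul0r => /eqP; rewrite subr_eq0 => /eqP.
have F_r z : 1 <= z -> F z = F 1.
  rewrite le_eqVlt => /predU1P[<-//|z1].
  have [c [/andP[c1 _]]] := MVT_everywhere dF z1.
  by rewrite b0_out ?(ltW c1) ?orbT// mul0r => /eqP; rewrite subr_eq0 => /eqP.
have [c [/andP[c0 c1]]] := MVT_everywhere dF (@ltr01 R).
rewrite subr0 mulr1 => F1; pose m := F 1 - F 0.
have m0 : 0 < m.
  by rewrite /m F1 /b0 lt_max; apply/orP; left; rewrite mulr_gt0// subr_gt0.
exists (fun z => m^-1 * (F z - F 0)), (fun z => m^-1 * b0 z); split.
- move=> z; have := is_deriveZ m^-1 (is_deriveB (dF z) (is_derive_cst (F 0) z 1)).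
  by rewrite subr0.
- by apply: continuous_mulf => //; exact: cst_continuous.
- by move=> z; rewrite mulr_ge0// invr_ge0 ltW.
- by move=> z /b0_out ->; rewrite mulr0.
- split; first by move=> z /F_l ->; rewrite subrr mulr0.
  by move=> z /F_r ->; rewrite mulVf// gt_eqF.
Qed.

(** Composing with the projection onto the unit interval keeps continuity and makes the extension
    constant on the negative axis, as [primitive_exists] requires. *)
Lemma clamp_extension (Y : R -> R) : {within `[0, 1], continuous Y} ->
  exists U, [/\ continuous U, forall z, 0 <= z <= 1 -> U z = Y z &
    forall z, z <= 0 -> U z = U 0].
Proof.
move=> /subspace_continuousP cY.
pose c (z : R) := Num.max (Num.min z 1) 0.
have c_lip x y : `|c x - c y| <= `|x - y|.
  wlog yx : x y / y <= x.
    by move=> H; have [/H//|/ltW/H] := leP y x; rewrite distrC (distrC x).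
  rewrite (@ger0_norm _ (x - y)) ?subr_ge0// ler_norml /c.
  have [?|?] := leP x 1; have [?|?] := leP y 1; have [?|?] := leP x 0;
    have [?|?] := leP y 0; rewrite ?(max_l (@ler01 R)); apply/andP; split; lra.
have c01 z : `[0, 1]%classic (c z).
  rewrite /= in_itv/= /c ge_max ler01 ge_min lexx orbT andbT.
  by rewrite le_max lexx orbT.
exists (Y \o c); split.
- move=> z; apply/cvgrPdist_lt => e e0.
  have /cvgrPdist_lt/(_ e e0) := cY _ (c01 z).
  rewrite near_withinE => -[d /= d0 dY]; exists d => //= x /= xz.
  by apply: dY; [exact: le_lt_trans (c_lip _ _) xz|exact: c01].
- by move=> z /andP[z0 z1]; rewrite /= /c min_l// max_l.
- by move=> z z0; rewrite /= /c min_l ?(le_trans z0)// max_r// min_l// max_r.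
Qed.

End energy_inequality.

Section cutoff.
Context {R : realType}.
Implicit Types (u v g U psi : R -> R).

(** chi_n = theta (N z - 1) - theta (N z - N + 2) with N = n + 3 rises from 0 to 1 between
    1/N and 2/N and falls back between 1 - 2/N and 1 - 1/N. Its derivative is the
    difference of two densities of mass one that concentrate at 0 and at 1, which is
    why the integral of G chi_n' tends to G 0 - G 1. *)
Lemma cutoff_exists : exists chi : nat -> R -> R,
  [/\ forall n, test_function (chi n), forall n z, 0 <= chi n z <= 1,
    forall z, 0 < z < 1 -> chi n z @[n --> \oo] --> (1 : R) &
    forall (G : R -> R) (e : R), continuous G -> 0 < e -> \forall n \near \oo,
      int01 (fun z => G z * derive1 (chi n) z) <= G 0 - G 1 + e].
Proof.
have [theta [b [dtheta cb b_ge0 b_out [theta0 theta1]]]] := @C1_step_exists R.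
have theta_mono x y : x <= y -> theta x <= theta y.
  rewrite le_eqVlt => /predU1P[->//|xy].
  have [c [_]] := MVT_everywhere dtheta xy.
  by rewrite -subr_ge0 => ->; rewrite mulr_ge0// subr_ge0 ltW.
have theta_ge0 x : 0 <= theta x.
  have [x0|x0] := leP x 0; first by rewrite theta0.
  by rewrite -(theta0 0 (lexx _)) theta_mono// ltW.
have theta_le1 x : theta x <= 1.
  have [x0|x0] := leP 1 x; first by rewrite theta1.
  by rewrite -(theta1 1 (lexx _)) theta_mono// ltW.
(* N >= 3 keeps the two transition zones apart and inside ]0, 1[. *)
pose N n : R := n.+3%:R.
have N3 n : 3 <= N n by rewrite ler_nat.
have N0 n : 0 < N n by have := N3 n; lra.
pose l n z := N n * z + -1; pose r n z := N n * z + (2 - N n).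
pose chi n z := theta (l n z) - theta (r n z).
pose bl n z := N n * b (l n z); pose br n z := N n * b (r n z).
have daff n (c z : R) : is_derive z 1 (fun x => theta (N n * x + c))
    (N n * b (N n * z + c)).
  have da : is_derive z 1 (fun x : R => N n * x + c) (N n).
    have := is_deriveD (is_deriveZ (N n) (is_derive_id z 1)) (is_derive_cst c z 1).
    by rewrite addr0 [_ *: _]mulr1.
  by have := @is_derive1_comp R theta (fun x => N n * x + c) z _ _ (dtheta _) da; rewrite mulrC.
have dl n (z : R) : is_derive z 1 (fun x => theta (l n x)) (bl n z) by exact: daff.
have dr n (z : R) : is_derive z 1 (fun x => theta (r n x)) (br n z) by exact: daff.
have dchi n (z : R) : is_derive z 1 (chi n) (bl n z - br n z) by exact: is_deriveB.
have cbl n : continuous (bl n).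
  by apply: continuous_mulf; [exact: cst_continuous|exact: continuous_affine].
have cbr n : continuous (br n).
  by apply: continuous_mulf; [exact: cst_continuous|exact: continuous_affine].
have chi' n : derive1 (chi n) = (fun z => bl n z - br n z) := derive1_eq (dchi n).
exists chi; split.
- move=> n; split.
  + by move=> z; case: (dchi n z).
  + by rewrite chi' => z; apply: cvgB; [exact: cbl|exact: cbr].
  + exists (N n)^-1, (1 - (N n)^-1); split.
    * by rewrite invr_gt0.
    * by rewrite ltrBlDr ltrDl invr_gt0.
    * move=> z; rewrite negb_and -!ltNge => /orP[z0|z0].
        have zN : N n * z < 1 by rewrite mulrC -ltr_pdivlMr// div1r.
        by rewrite /chi !theta0 ?subrr// /l /r; have := N3 n; lra.
      have zN : N n - 1 < N n * z.
        by move: z0; rewrite -(ltr_pM2l (N0 n)) mulrBr mulr1 divff// gt_eqF.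
      by rewrite /chi !theta1 ?subrr// /l /r; have := N3 n; lra.
- move=> n z; rewrite subr_ge0 theta_mono/=; last by rewrite /l /r; have := N3 n; lra.
  by rewrite lerBlDr (le_trans (theta_le1 _))// lerDl.
- move=> z /andP[z0 z1]; apply: cvg_near_cst; near=> n.
  have nN : n%:R <= N n by rewrite ler_nat -addn3 leq_addr.
  have zN : 2 <= N n * z.
    rewrite -ler_pdivrMr//; apply: le_trans nN; near: n; exact: nbhs_infty_ger.
  have zN' : 2 <= N n * (1 - z).
    rewrite -ler_pdivrMr ?subr_gt0//; apply: le_trans nN; near: n.
    exact: nbhs_infty_ger.
  rewrite /chi theta1 ?theta0 ?subr0//; rewrite /l /r; first by lra.
  by move: zN'; rewrite mulrBr mulr1; lra.
- move=> G e cG e0.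
  have e20 : 0 < e / 2 by rewrite divr_gt0.
  have /cvgrPdist_lt/(_ _ e20)[d0 /= d0_gt0 G_0] := cG (0 : R).
  have /cvgrPdist_lt/(_ _ e20)[d1 /= d1_gt0 G_1] := cG (1 : R).
  near=> n.
  have nN : n%:R <= N n by rewrite ler_nat -addn3 leq_addr.
  have Nd0 : 2 < N n * d0.
    rewrite -ltr_pdivrMr//; apply: lt_le_trans nN; near: n; exact: nbhs_infty_gtr.
  have Nd1 : 2 < N n * d1.
    rewrite -ltr_pdivrMr//; apply: lt_le_trans nN; near: n; exact: nbhs_infty_gtr.
  have int_l : int01 (bl n) = 1.
    rewrite (int01_FTC (dl n))// theta1 ?theta0 ?subr0// /l; have := N3 n; lra.
  have int_r : int01 (br n) = 1.
    rewrite (int01_FTC (dr n))// theta1 ?theta0 ?subr0// /r; have := N3 n; lra.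
  have ibl := integrable01_continuous (cbl n).
  have ibr := integrable01_continuous (cbr n).
  have -> : G 0 - G 1 + e =
      int01 (fun z => (G 0 + e / 2) * bl n z - (G 1 - e / 2) * br n z).
    rewrite int01B; [|exact: integrable01Z..].
    by rewrite (int01Z _ ibl) (int01Z _ ibr) int_l int_r; lra.
  apply: le_int01.
  + apply: integrable01_continuous; rewrite chi'; apply: continuous_mulf => // z.
    by apply: cvgB; [exact: cbl|exact: cbr].
  + by apply: integrable01B; exact: integrable01Z.
  + move=> z /andP[z0 z1]; rewrite chi' mulrBr; apply: lerB.
      have [lz|] := boolP ((l n z <= 0) || (1 <= l n z)).
        by rewrite /bl b_out// !mulr0.
      rewrite negb_or -!ltNge => /andP[lz0 lz1].
      rewrite ler_wpM2r ?mulr_ge0 ?(ltW (N0 n))//.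
      have /G_0 : ball_ Num.norm 0 d0 z.
        rewrite /ball_/= sub0r normrN gtr0_norm// -(ltr_pM2l (N0 n)).
        by move: lz1; rewrite /l; lra.
      by rewrite ltr_norml => /andP[]; lra.
    have [rz|] := boolP ((r n z <= 0) || (1 <= r n z)).
      by rewrite /br b_out// !mulr0.
    rewrite negb_or -!ltNge => /andP[rz0 rz1].
    rewrite ler_wpM2r ?mulr_ge0 ?(ltW (N0 n))//.
    have /G_1 : ball_ Num.norm 1 d1 z.
      rewrite /ball_/= gtr0_norm ?subr_gt0// -(ltr_pM2l (N0 n)) mulrBr mulr1.
      by move: rz0; rewrite /r; lra.
    by rewrite ltr_norml => /andP[]; lra.
Unshelve. all: by end_near. Qed.

(** Formally the derivative of e^(-mu z) Y^2 / 2 integrated from 0 to 1. It follows from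
    the interior inequality for psi = e^(-mu z) chi_n as the cutoff chi_n exhausts the
    interval: the derivative of the weight gives the mu-term and the derivative of the
    cutoff gives the boundary values. *)
Lemma energy_inequality u g (Y : R -> R) (mu : R) :
  L2scalar u -> L2scalar g -> weak_derivative_scalar u g ->
  {within `[0, 1], continuous Y} ->
  Y = u %[ae @lebesgue_measure R in `]0, 1[%classic] ->
  (Y 1 ^+ 2 * expR (- mu) - Y 0 ^+ 2) / 2 +
    mu / 2 * int01 (fun z => expR (- mu * z) * u z ^+ 2) <=
  int01 (fun z => expR (- mu * z) * (u z * g z)).
Proof.
move=> Lu Lg wug cY Yu.
have [U [cU UY U0]] := clamp_extension cY.
have Uu : U = u %[ae @lebesgue_measure R in `]0, 1[%classic].
  move: Yu; apply: (@filterS _ _ (ae_filter_ringOfSetsType _)) => z Yu Dz.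
  by rewrite UY ?Yu//; move: Dz; rewrite /= in_itv/= => /andP[z0 z1]; rewrite !ltW.
have [chi [tchi chi01 chi_cvg chi_int]] := @cutoff_exists.
pose w z := expR (- mu * z).
have dw (z : R) : is_derive z 1 w (- mu * w z).
  have := @is_derive1_comp R expR (fun x => - mu * x) z _ _ (is_derive_expR _)
    (is_deriveZ (- mu) (is_derive_id z 1)).
  by rewrite mulrC [_ *: _]mulr1.
have cw := derive_continuous dw.
have cw' : continuous (fun z => - mu * w z).
  by apply: continuous_mulf => //; exact: cst_continuous.
have cU2 : continuous (fun z => U z ^+ 2) by apply: continuous_mulf.
have cG : continuous (fun z => U z ^+ 2 * w z) by apply: continuous_mulf.
have cchi n : continuous (chi n).
  have [d _ _] := tchi n.
  by apply: (@derive_continuous _ _ (derive1 (chi n))) => z; rewrite derive1E; exact: derivableP.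
have iG := integrable01_continuous cG.
have iwUg : integrable01 (fun z => w z * (U z * g z)).
  by do 2 apply: integrable01M => //; exact: L2scalar_integrable.
have step n : int01 (fun z => chi n z * (mu / 2 * (U z ^+ 2 * w z))) -
      int01 (fun z => U z ^+ 2 * w z * derive1 (chi n) z) / 2 <=
    int01 (fun z => chi n z * (w z * (U z * g z))).
  have [tw dwchi] := test_functionM dw cw' (tchi n).
  have w_chi_ge0 z : 0 < z < 1 -> 0 <= w z * chi n z.
    by move=> _; rewrite mulr_ge0 ?expR_ge0//; have /andP[] := chi01 n z.
  have := energy_inequality_interior Lu Lg wug cU U0 Uu tw w_chi_ge0.
  have -> : int01 (fun z => U z * (g z * (w z * chi n z))) =
      int01 (fun z => chi n z * (w z * (U z * g z))).
    by apply: eq_int01 => z _; ring.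
  apply: le_trans; rewrite dwchi.
  have [_ cchi' _] := tchi n.
  have i1 : integrable01 (fun z => chi n z * (mu / 2 * (U z ^+ 2 * w z))).
    by apply: integrable01M => //; exact: integrable01Z.
  have i2 : integrable01 (fun z => U z ^+ 2 * w z * derive1 (chi n) z).
    by apply: integrable01_continuous; exact: continuous_mulf.
  have -> : int01 (fun z => U z ^+ 2 * (- mu * w z * chi n z + w z * derive1 (chi n) z)) =
      int01 (fun z => (- 2) * (chi n z * (mu / 2 * (U z ^+ 2 * w z))) +
        U z ^+ 2 * w z * derive1 (chi n) z).
    by apply: eq_int01 => z _; field.
  rewrite int01D//; last exact: integrable01Z.
  by rewrite int01Z//; lra.
have cv1 : int01 (fun z => chi n z * (mu / 2 * (U z ^+ 2 * w z))) @[n --> \oo] -->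
    mu / 2 * int01 (fun z => U z ^+ 2 * w z).
  rewrite -int01Z//.
  have -> : int01 (fun z => mu / 2 * (U z ^+ 2 * w z)) =
    int01 (fun z => 1 * (mu / 2 * (U z ^+ 2 * w z))).
    by apply: eq_int01 => z _; rewrite mul1r.
  apply: (int01_dominated (M := 1) (g := fun=> 1)) => //.
  - exact: integrable01Z.
  - exact: cst_continuous.
  - by move=> n z _; have /andP[? ?] := chi01 n z; rewrite ger0_norm.
have cv2 : int01 (fun z => chi n z * (w z * (U z * g z))) @[n --> \oo] -->
    int01 (fun z => w z * (U z * g z)).
  have -> : int01 (fun z => w z * (U z * g z)) = int01 (fun z => 1 * (w z * (U z * g z))).
    by apply: eq_int01 => z _; rewrite mul1r.
  apply: (int01_dominated (M := 1) (g := fun=> 1)) => //.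
  - exact: cst_continuous.
  - by move=> n z _; have /andP[? ?] := chi01 n z; rewrite ger0_norm.
have -> : int01 (fun z => expR (- mu * z) * u z ^+ 2) = int01 (fun z => U z ^+ 2 * w z).
  apply: eq_int01_ae => //.
  - apply: (integrable01M cw); apply: eq_integrable01 (integrable01_L2 Lu Lu) => z _.
    by rewrite expr2.
  - move: Uu; apply: (@filterS _ _ (ae_filter_ringOfSetsType _)) => z Uu Dz.
    by rewrite Uu// mulrC.
have -> : int01 (fun z => expR (- mu * z) * (u z * g z)) =
    int01 (fun z => w z * (U z * g z)).
  apply: eq_int01_ae => //.
  - by apply: (integrable01M cw); exact: integrable01_L2.
  - move: Uu; apply: (@filterS _ _ (ae_filter_ringOfSetsType _)) => z Uu Dz.
    by rewrite Uu.
rewrite -!UY ?lexx ?ler01//.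
apply/ler_addgt0Pr => e e0.
have lim_le : mu / 2 * int01 (fun z => U z ^+ 2 * w z) -
    (U 0 ^+ 2 - U 1 ^+ 2 * expR (- mu) + e) / 2 <= int01 (fun z => w z * (U z * g z)).
  apply: (ler_cvg_to (cvgB cv1 (cvg_cst _)) cv2).
  have := chi_int _ _ cG e0; apply: filterS => n.
  rewrite /w mulr0 expR0 !mulr1; have := step n; rewrite /w.
  set a := int01 _; set b := int01 _; set c := int01 _ => h1 h2.
  rewrite [leLHS](_ : _ = a - (U 0 ^+ 2 - U 1 ^+ 2 * expR (- mu) + e) / 2)//; lra.
by move: lim_le; lra.
Qed.

End cutoff.

(** * Weighted inner products on L^2 *)

Section weighted_inner_product.
Context {R : realType} {k : nat}.
Implicit Types (f g h : R -> 'cV[R]_k) (p : 'I_k -> R) (mu c : R).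

(** [wip p mu f f] is the Lyapunov functional for the diagonal weight p; the choice
    p = 1, mu = 0 gives the L^2 inner product, so that both norms share one theory. *)
Definition wip p mu f g : R :=
  int01 (fun z => expR (- mu * z) * \sum_i p i * (f z i 0 * g z i 0)).

Definition wnorm p mu f : R := Num.sqrt (wip p mu f f).

Lemma in_L2D f g : in_L2 f -> in_L2 g -> in_L2 (f + g).
Proof.
move=> Lf Lg i; have := L2scalarD (Lf i) (Lg i); rewrite /L2scalar.
by under [X in _ -> (X \_ _) \in _]eq_fun do rewrite mxE.
Qed.

Lemma in_L2Z c f : in_L2 f -> in_L2 (c *: f).
Proof.
move=> Lf i; have := L2scalarZ c (Lf i); rewrite /L2scalar.
by under [X in _ -> (X \_ _) \in _]eq_fun do rewrite mxE.
Qed.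

Lemma in_L2N f : in_L2 f -> in_L2 (- f).
Proof. by rewrite -scaleN1r; exact: in_L2Z. Qed.

Lemma in_L2B f g : in_L2 f -> in_L2 g -> in_L2 (f - g).
Proof. by move=> Lf Lg; apply: in_L2D => //; exact: in_L2N. Qed.

Lemma continuous_weight mu : continuous (fun z : R => expR (- mu * z)).
Proof.
move=> z; apply: (@continuous_comp _ _ _ (fun x : R => - mu * x) expR).
  by apply: cvgMr; exact: cvg_id.
exact: continuous_expR.
Qed.

Lemma integrable_wip p mu f g : in_L2 f -> in_L2 g ->
  integrable01 (fun z => expR (- mu * z) * \sum_i p i * (f z i 0 * g z i 0)).
Proof.
move=> Lf Lg; apply: integrable01M; first exact: continuous_weight.
by apply: integrable01_sum => i; apply: integrable01Z;
  exact: (integrable01_L2 (Lf i) (Lg i)).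
Qed.

Lemma wip_sum p mu f g : in_L2 f -> in_L2 g ->
  wip p mu f g =
  \sum_i p i * int01 (fun z => expR (- mu * z) * (f z i 0 * g z i 0)).
Proof.
move=> Lf Lg; have ifg i : integrable01 (fun z => expR (- mu * z) * (f z i 0 * g z i 0)).
  apply: integrable01M; first exact: continuous_weight.
  exact: (integrable01_L2 (Lf i) (Lg i)).
transitivity (int01 (fun z => \sum_i p i * (expR (- mu * z) * (f z i 0 * g z i 0)))).
  by apply: eq_int01 => z _; rewrite mulr_sumr; apply: eq_bigr => i _; rewrite mulrCA.
rewrite int01_sum; last by move=> i; exact: integrable01Z.
by apply: eq_bigr => i _; rewrite int01Z.
Qed.

Lemma wipC p mu f g : wip p mu f g = wip p mu g f.
Proof.
apply: eq_int01 => z _; congr (_ * _).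
by apply: eq_bigr => i _; rewrite (mulrC (f z i 0)).
Qed.

Lemma wipDl p mu f g h : in_L2 f -> in_L2 g -> in_L2 h ->
  wip p mu (f + g) h = wip p mu f h + wip p mu g h.
Proof.
move=> Lf Lg Lh; rewrite -int01D; [|exact: integrable_wip..].
apply: eq_int01 => z _; rewrite -mulrDr -big_split/=; congr (_ * _).
by apply: eq_bigr => i _; rewrite mxE; ring.
Qed.

Lemma wipZl p mu c f g : in_L2 f -> in_L2 g ->
  wip p mu (c *: f) g = c * wip p mu f g.
Proof.
move=> Lf Lg; rewrite -int01Z; last exact: integrable_wip.
apply: eq_int01 => z _; rewrite [RHS]mulrCA [in RHS]mulr_sumr; congr (_ * _).
by apply: eq_bigr => i _; rewrite mxE; ring.
Qed.

Lemma wipDr p mu f g h : in_L2 f -> in_L2 g -> in_L2 h ->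
  wip p mu f (g + h) = wip p mu f g + wip p mu f h.
Proof. by move=> Lf Lg Lh; rewrite wipC wipDl// wipC (wipC _ _ h). Qed.

Lemma wipZr p mu c f g : in_L2 f -> in_L2 g ->
  wip p mu f (c *: g) = c * wip p mu f g.
Proof. by move=> Lf Lg; rewrite wipC wipZl// wipC. Qed.

Lemma wipBr p mu f g h : in_L2 f -> in_L2 g -> in_L2 h ->
  wip p mu f (g - h) = wip p mu f g - wip p mu f h.
Proof.
move=> Lf Lg Lh; rewrite wipDr//; last exact: in_L2N.
by rewrite -(scaleN1r h) wipZr// mulN1r.
Qed.

Lemma wip_ge0 p mu f : (forall i, 0 <= p i) -> 0 <= wip p mu f f.
Proof.
move=> p0; apply: int01_ge0 => z _; rewrite mulr_ge0 ?expR_ge0// sumr_ge0// => i _.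
by rewrite mulr_ge0// -expr2 sqr_ge0.
Qed.

Lemma wnorm_ge0 p mu f : 0 <= wnorm p mu f.
Proof. exact: sqrtr_ge0. Qed.

Lemma wnorm_sqr p mu f : (forall i, 0 <= p i) -> wnorm p mu f ^+ 2 = wip p mu f f.
Proof. by move=> p0; rewrite sqr_sqrtr// wip_ge0. Qed.

Lemma wip_add_sqr p mu (a b : R) f g : in_L2 f -> in_L2 g ->
  wip p mu (a *: f + b *: g) (a *: f + b *: g) =
  a ^+ 2 * wip p mu f f + 2 * a * b * wip p mu f g + b ^+ 2 * wip p mu g g.
Proof.
move=> Lf Lg; have Laf := in_L2Z a Lf; have Lbg := in_L2Z b Lg.
rewrite wipDl ?wipDr ?wipZl ?wipZr//; last exact: in_L2D.
by rewrite (wipC _ _ g f); ring.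
Qed.

(** The form is nonnegative on a f + b g for all a and b. If the inequality failed,
    it would be negative for (a, b) = (|g|, - |f|) or, when f is a null vector, for
    b = 1 and a = - (|g|^2 + 1) / (2 <f, g>), and symmetrically for g. *)
Lemma wip_cauchy_schwarz p mu f g : (forall i, 0 <= p i) -> in_L2 f -> in_L2 g ->
  wip p mu f g <= wnorm p mu f * wnorm p mu g.
Proof.
move=> p0 Lf Lg.
have H (a b : R) : 0 <= a ^+ 2 * wip p mu f f + 2 * a * b * wip p mu f g +
    b ^+ 2 * wip p mu g g by rewrite -wip_add_sqr// wip_ge0.
rewrite -(wnorm_sqr _ f p0) -(wnorm_sqr _ g p0) in H.
have := wnorm_ge0 p mu f; have := wnorm_ge0 p mu g.
move: H; set x := wnorm p mu f; set y := wnorm p mu g; set s := wip p mu f g.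
move=> H y0 x0.
rewrite leNgt; apply/negP => s_gt; have s0 : 0 < s by nra.
have := H (- (y ^+ 2 + 1) / (2 * s)) 1.
have := H 1 (- (x ^+ 2 + 1) / (2 * s)).
have := H y (- x).
have [->|x_neq0] := eqVneq x 0.
  have -> : 2 * (- (y ^+ 2 + 1) / (2 * s)) * 1 * s = - (y ^+ 2 + 1).
    by field; rewrite gt_eqF.
  by rewrite expr0n/=; lra.
have [->|y_neq0] := eqVneq y 0.
  have -> : 2 * 1 * (- (x ^+ 2 + 1) / (2 * s)) * s = - (x ^+ 2 + 1).
    by field; rewrite gt_eqF.
  by rewrite expr0n/=; lra.
have xy0 : 0 < x * y by rewrite mulr_gt0 ?lt_neqAle ?x0 ?y0 ?andbT 1?eq_sym.
have -> : y ^+ 2 * x ^+ 2 + 2 * y * - x * s + (- x) ^+ 2 * y ^+ 2 =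
  - (2 * (x * y) * (s - x * y)) by ring.
have : 0 < 2 * (x * y) * (s - x * y) by rewrite mulr_gt0 ?subr_gt0// mulr_gt0.
by lra.
Qed.

Lemma wnorm_triangle p mu f g : (forall i, 0 <= p i) -> in_L2 f -> in_L2 g ->
  wnorm p mu (f + g) <= wnorm p mu f + wnorm p mu g.
Proof.
move=> p0 Lf Lg; rewrite -ler_sqr ?nnegrE ?addr_ge0 ?wnorm_ge0//.
rewrite wnorm_sqr// wipDl ?wipDr//; last exact: in_L2D.
rewrite sqrrD !wnorm_sqr// (wipC _ _ g f).
by have := wip_cauchy_schwarz mu p0 Lf Lg; lra.
Qed.

Lemma wip_ae p mu f g h : in_L2 f -> in_L2 g -> in_L2 h -> L2eq g h ->
  wip p mu f g = wip p mu f h.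
Proof.
move=> Lf Lg Lh gh; apply: eq_int01_ae; [exact: integrable_wip..|].
by move: gh; apply: (@filterS _ _ (ae_filter_ringOfSetsType _)) => z gh Dz; rewrite gh.
Qed.

Lemma L2normE f : L2norm f = wnorm (fun=> 1) 0 f.
Proof.
congr Num.sqrt; apply: eq_int01 => z _; rewrite oppr0 mul0r expR0 mul1r.
by apply: eq_bigr => i _; rewrite mul1r expr2.
Qed.

Lemma L2norm_ge0 f : 0 <= L2norm f. Proof. exact: sqrtr_ge0. Qed.

Lemma L2norm_sqr f : L2norm f ^+ 2 = wip (fun=> 1) 0 f f.
Proof. by rewrite L2normE wnorm_sqr. Qed.

Lemma L2norm_triangle f g : in_L2 f -> in_L2 g ->
  L2norm (f + g) <= L2norm f + L2norm g.
Proof. by move=> Lf Lg; rewrite !L2normE; apply: wnorm_triangle. Qed.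

Lemma L2normN f : L2norm (- f) = L2norm f.
Proof.
congr Num.sqrt; apply: eq_int01 => z _.
by apply: eq_bigr => i _; rewrite mxE sqrrN.
Qed.

Lemma L2norm_distC f g : L2norm (f - g) = L2norm (g - f).
Proof. by rewrite -L2normN opprB. Qed.

Lemma L2norm_dist_le f g : in_L2 f -> in_L2 g ->
  `|L2norm f - L2norm g| <= L2norm (f - g).
Proof.
move=> Lf Lg; have Lfg := in_L2B Lf Lg; have Lgf := in_L2B Lg Lf.
have := L2norm_triangle Lfg Lg; have := L2norm_triangle Lgf Lf.
by rewrite !subrK (L2norm_distC g) ler_norml => ? ?; apply/andP; split; lra.
Qed.

(** On ]0, 1[ the weight e^(-mu z) lies between e^(-mu) and 1; the same fact gives
    [wip_ge_L2norm]. *)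
Lemma wip_le_L2norm p mu c f : 0 <= mu -> (forall i, 0 <= p i <= c) -> in_L2 f ->
  wip p mu f f <= c * L2norm f ^+ 2.
Proof.
move=> mu0 pc Lf; rewrite L2norm_sqr -int01Z; last exact: integrable_wip.
apply: le_int01; [exact: integrable_wip|exact/integrable01Z/integrable_wip|].
move=> z /andP[z0 z1]; rewrite oppr0 mul0r expR0 mul1r mulr_sumr mulr_sumr.
apply: ler_sum => i _; have /andP[p0 p_le] := pc i.
have ff : 0 <= f z i 0 * f z i 0 by rewrite -expr2 sqr_ge0.
have e1 : expR (- mu * z) <= 1 by rewrite expR_le1; nra.
rewrite mul1r mulrA ler_wpM2r// -[leRHS]mul1r.
by apply: ler_pM => //; exact: expR_ge0.
Qed.

Lemma wip_ge_L2norm p mu c f : 0 <= mu -> 0 <= c -> (forall i, c <= p i) -> in_L2 f ->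
  c * expR (- mu) * L2norm f ^+ 2 <= wip p mu f f.
Proof.
move=> mu0 c0 pc Lf; rewrite L2norm_sqr -int01Z; last exact: integrable_wip.
apply: le_int01; [exact/integrable01Z/integrable_wip|exact: integrable_wip|].
move=> z /andP[z0 z1]; rewrite oppr0 mul0r expR0 mul1r mulr_sumr mulr_sumr.
apply: ler_sum => i _.
have ff : 0 <= f z i 0 * f z i 0 by rewrite -expr2 sqr_ge0.
have e1 : expR (- mu) <= expR (- mu * z) by rewrite ler_expR; nra.
rewrite mul1r [leRHS]mulrA ler_wpM2r// mulrC.
by apply: ler_pM => //; exact: expR_ge0.
Qed.

End weighted_inner_product.

(** * Diagonal matrices and block quadratic forms *)

Section diagonal_matrices.
Context {R : realType}.

Lemma dotE k (u v : 'cV[R]_k) : (u^T *m v) 0 0 = \sum_i u i 0 * v i 0.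
Proof. by rewrite mxE; apply: eq_bigr => i _; rewrite mxE. Qed.

Lemma mul_diagE k l (M : 'M[R]_k) (A : 'M[R]_(k, l)) i j : is_diag_mx M ->
  (M *m A) i j = M i i * A i j.
Proof.
move=> /is_diag_mxP dM; rewrite mxE (bigD1 i)//= big1 ?addr0// => s si.
by rewrite dM ?mul0r// eq_sym.
Qed.

(** The diagonal entries are the values of the quadratic form at the unit vectors. *)
Lemma posdef_diag_gt0 k (M : 'M[R]_k) i : posdef M -> 0 < M i i.
Proof.
move=> [_ /(_ (delta_mx i 0))]; rewrite trmx_delta -rowE -colE !mxE; apply.
by apply/eqP => /matrixP/(_ i 0); rewrite !mxE !eqxx/= => /eqP; rewrite oner_eq0.
Qed.

Lemma quad_block k l (A : 'M[R]_k) (E : 'M[R]_(k, l)) (D : 'M[R]_l)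
    (x : 'cV[R]_k) (y : 'cV[R]_l) :
  ((col_mx x y)^T *m (block_mx A E E^T D *m col_mx x y)) 0 0 =
  (x^T *m (A *m x)) 0 0 + 2 * (x^T *m (E *m y)) 0 0 + (y^T *m (D *m y)) 0 0.
Proof.
rewrite tr_col_mx mulmxA mul_row_block mul_row_col !mulmxDl -!mulmxA.
have -> : y^T *m (E^T *m x) = (x^T *m (E *m y))^T by rewrite !trmx_mul trmxK mulmxA.
move: (x^T *m _) (x^T *m (E *m _)) (y^T *m _) => a b c.
by rewrite !mxE; ring.
Qed.

Lemma invmx_diag k (M : 'M[R]_k) : is_diag_mx M ->
  (forall i, M i i != 0) ->
  [/\ M \in unitmx, is_diag_mx (invmx M) & forall i, invmx M i i = (M i i)^-1].
Proof.
move=> dM M0; pose D := diag_mx (\row_i (M i i)^-1).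
have MD : M *m D = 1%:M.
  apply/matrixP => i j; rewrite mul_diagE// !mxE.
  by case: eqVneq => [->|_]; rewrite ?mulr1n ?mulr0n ?mulr0// mulfV.
have [uM _] := mulmx1_unit MD.
have -> : invmx M = D by rewrite -[RHS](mulKmx uM) MD mulmx1.
split=> //; first exact: diag_mx_is_diag.
by move=> i; rewrite !mxE eqxx mulr1n.
Qed.

End diagonal_matrices.


(** * Dissipation from the matrix inequalities *)

Section linear_matrix_inequalities.
Context {R : realType} {n m q : nat}.
Variables (Lambda H : 'M[R]_n) (B : 'M[R]_(n, m)) (N : 'M[R]_(n, q)).
Variable ubar : 'I_m -> R.
Variables (Q : 'M[R]_n) (S : 'M[R]_m) (Gamma : 'M[R]_n) (mu alpha : R).
Variable W : 'M[R]_(m, n).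
Hypotheses (Lambda_diag : is_diag_mx Lambda) (Lambda_pos : posdef Lambda).
Hypothesis ubar_pos : forall i, 0 < ubar i.
Hypotheses (Q_diag : is_diag_mx Q) (Q_pos : posdef Q).
Hypotheses (S_diag : is_diag_mx S) (S_pos : posdef S).
Hypothesis mu_ge0 : 0 <= mu.
Hypothesis LMI1 : negsemidef
  (block_mx
    (- (Q *m invmx Lambda))
    (row_mx (H *m Q + B *m W) (B *m S))
    (col_mx (H *m Q + B *m W)^T (B *m S)^T)
    (block_mx (- (expR (- mu) *: (Lambda *m Q))) (- W^T)
              (- W) (- (2 *: S)))).
Hypothesis LMI2 : possemidef (block_mx Gamma N N^T 1%:M).
Hypothesis LMI3 : negsemidef (Q *m (alpha%:M - mu *: Lambda) + Gamma).

Local Notation K := (W *m invmx Q).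
Local Notation p := (fun i : 'I_n => (Q i i)^-1).
Let invQ := invmx_diag Q_diag (fun i => lt0r_neq0 (posdef_diag_gt0 i Q_pos)).
Let invS := invmx_diag S_diag (fun i => lt0r_neq0 (posdef_diag_gt0 i S_pos)).
Let invL := invmx_diag Lambda_diag (fun i => lt0r_neq0 (posdef_diag_gt0 i Lambda_pos)).
Let Q0 i : 0 < Q i i := posdef_diag_gt0 i Q_pos.
Let L0 i : 0 < Lambda i i := posdef_diag_gt0 i Lambda_pos.
Let S0 i : 0 < S i i := posdef_diag_gt0 i S_pos.

(** The deadzone is minus the part of u that saturation removes, and adding u recovers
    the saturation, which has the sign of u: the two factors have opposite signs. *)
Lemma deadzone_sector (u : 'cV[R]_m) i :
  deadzone ubar u i 0 * (deadzone ubar u i 0 + u i 0) <= 0.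
Proof.
rewrite /deadzone !mxE subrK; set v := u i 0; have b0 := ubar_pos i.
have [v0|v0|->] := ltrgt0P v; last by rewrite sgr0 !mulr0.
  rewrite gtr0_sg// mulr1.
  by have [?|?] := leP v (ubar i); nra.
rewrite ltr0_sg// mulrN1.
by have [?|?] := leP (- v) (ubar i); nra.
Qed.

(** Schur complement by hand: for fixed b = P y1 and c = S^-1 phi the off-diagonal block
    applied to (b, c) is y0, and a = Lambda P y0 maximises the quadratic form in a. Its
    value is the difference of the two sums minus 2 phi^T S^-1 (phi + K y1), and the
    subtracted term is nonpositive by the sector condition. *)
Lemma boundary_dissipation (y0 y1 : 'cV[R]_n) :
  y0 = Hcl H B K *m y1 + B *m deadzone ubar (K *m y1) ->
  \sum_i (Q i i)^-1 * Lambda i i * (y0 i 0 ^+ 2) <=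
  expR (- mu) * \sum_i (Q i i)^-1 * Lambda i i * (y1 i 0 ^+ 2).
Proof.
set phi := deadzone ubar (K *m y1) => y0E.
pose a : 'cV[R]_n := Lambda *m (invmx Q *m y0).
pose b : 'cV[R]_n := invmx Q *m y1.
pose c : 'cV[R]_m := invmx S *m phi.
have [[uQ _ _] [uS _ _]] := (invQ, invS).
have y0E' : (H *m Q + B *m W) *m b + (B *m S) *m c = y0.
  rewrite y0E /b /c !mulmxDl -!mulmxA (mulKVmx uQ).
  by rewrite (mulKVmx uS).
have [_ dP Pii] := invQ; have [_ dSi Sii] := invS; have [_ dLi Lii] := invL.
have aE i : a i 0 = Lambda i i * ((Q i i)^-1 * y0 i 0) by rewrite !mul_diagE// Pii.
have bE i : b i 0 = (Q i i)^-1 * y1 i 0 by rewrite mul_diagE// Pii.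
have cE i : c i 0 = (S i i)^-1 * phi i 0 by rewrite mul_diagE// Sii.
have Wb : W *m b = K *m y1 by rewrite mulmxA.
move: a b c aE bE cE Wb y0E' => a b c aE bE cE Wb y0E'.
have [_ /(_ (col_mx a (col_mx b c)))] := LMI1.
rewrite mulmxN mulNmx mxE oppr_ge0 -mulmxA -tr_row_mx quad_block mul_row_col y0E'.
have -> : block_mx (- (expR (- mu) *: (Lambda *m Q))) (- W^T) (- W) (- (2 *: S)) =
    block_mx (- (expR (- mu) *: (Lambda *m Q))) (- W^T) (- W^T)^T (- (2 *: S)).
  by rewrite linearN/= trmxK.
rewrite quad_block !dotE.
have -> : \sum_i a i 0 * (- (Q *m invmx Lambda) *m a) i 0 =
    - \sum_i (Q i i)^-1 * Lambda i i * (y0 i 0 ^+ 2).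
  rewrite -sumrN; apply: eq_bigr => i _.
  rewrite mulNmx mxE -mulmxA !mul_diagE// Lii aE.
  by have := L0 i; have := Q0 i => *; field; rewrite !gt_eqF.
have -> : \sum_i a i 0 * y0 i 0 = \sum_i (Q i i)^-1 * Lambda i i * (y0 i 0 ^+ 2).
  by apply: eq_bigr => i _; rewrite aE; ring.
have -> : \sum_i b i 0 * (- (expR (- mu) *: (Lambda *m Q)) *m b) i 0 =
    - (expR (- mu) * \sum_i (Q i i)^-1 * Lambda i i * (y1 i 0 ^+ 2)).
  rewrite mulr_sumr -sumrN; apply: eq_bigr => i _.
  rewrite mulNmx mxE -scalemxAl mxE -mulmxA !mul_diagE// bE.
  by have := Q0 i => *; field; rewrite !gt_eqF.
have -> : \sum_i b i 0 * (- W^T *m c) i 0 =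
    - \sum_i (S i i)^-1 * (phi i 0 * (K *m y1) i 0).
  rewrite -dotE mulNmx mulmxN mxE; congr (- _).
  have -> : b^T *m (W^T *m c) = (c^T *m (W *m b))^T by rewrite !trmx_mul trmxK mulmxA.
  rewrite mxE dotE; apply: eq_bigr => i _.
  by rewrite cE Wb mulrA.
have -> : \sum_i c i 0 * (- (2 *: S) *m c) i 0 =
    - (2 * \sum_i (S i i)^-1 * (phi i 0 * phi i 0)).
  rewrite mulr_sumr -sumrN; apply: eq_bigr => i _.
  rewrite mulNmx mxE -scalemxAl mxE !mul_diagE// cE.
  by have := S0 i => *; field; rewrite !gt_eqF.
have : \sum_i (S i i)^-1 * (phi i 0 * phi i 0) +
    \sum_i (S i i)^-1 * (phi i 0 * (K *m y1) i 0) <= 0.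
  rewrite -big_split/= sumr_le0// => i _; rewrite -!mulrDr.
  by rewrite pmulr_rle0 ?invr_gt0// deadzone_sector.
set s1 := \sum_i _; set s2 := \sum_i _; set s3 := \sum_i _; set s4 := \sum_i _.
by move=> h1 h2; lra.
Qed.

(** With v = P x, the second inequality tested on (v, - y) bounds 2 v^T N y by
    v^T Gamma v + |y|^2, and the third one tested on v bounds v^T Gamma v by
    mu x^T P Lambda x - alpha x^T P x. *)
Lemma supply_rate (x : 'cV[R]_n) (y : 'cV[R]_q) :
  2 * \sum_i (Q i i)^-1 * (x i 0 * (N *m y) i 0) <=
  mu * (\sum_i (Q i i)^-1 * Lambda i i * (x i 0 * x i 0)) -
  alpha * (\sum_i (Q i i)^-1 * (x i 0 * x i 0)) +
  \sum_j y j 0 ^+ 2.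
Proof.
have [_ dP Pii] := invQ.
pose v : 'cV[R]_n := invmx Q *m x.
have vE i : v i 0 = (Q i i)^-1 * x i 0 by rewrite mul_diagE// Pii.
move: v vE => v vE.
have [_ /(_ (col_mx v (- y)))] := LMI2; rewrite -mulmxA quad_block !dotE.
have [_ /(_ v)] := LMI3; rewrite mulmxN mulNmx mxE oppr_ge0 -mulmxA mulmxDl mulmxDr mxE.
rewrite !dotE.
have -> : \sum_i v i 0 * (Q *m (alpha%:M - mu *: Lambda) *m v) i 0 =
    alpha * (\sum_i (Q i i)^-1 * (x i 0 * x i 0)) -
    mu * (\sum_i (Q i i)^-1 * Lambda i i * (x i 0 * x i 0)).
  rewrite !mulr_sumr -sumrB; apply: eq_bigr => i _.
  have Lv : Lambda *m v = \col_j (Lambda j j * v j 0).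
    by apply/matrixP => j l; rewrite (ord1 l) mul_diagE// mxE.
  rewrite -mulmxA mul_diagE// mulmxBl mul_scalar_mx -scalemxAl Lv !mxE vE.
  by have := Q0 i => *; field; rewrite !gt_eqF.
have -> : \sum_i v i 0 * (N *m - y) i 0 = - \sum_i (Q i i)^-1 * (x i 0 * (N *m y) i 0).
  rewrite -sumrN; apply: eq_bigr => i _; rewrite mulmxN mxE vE; ring.
have -> : \sum_i (- y) i 0 * (1%:M *m - y) i 0 = \sum_j y j 0 ^+ 2.
  by apply: eq_bigr => i _; rewrite mul1mx !mxE; ring.
by set s1 := \sum_i _; set s2 := \sum_i _; set s3 := \sum_i _; set s4 := \sum_i _;
  set s5 := \sum_j _; lra.
Qed.

Lemma opA_comp (X : R -> 'cV[R]_n) z i :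
  opA Lambda X z i 0 = - (Lambda i i * weak_derivative X z i 0).
Proof. by rewrite /opA mxE mul_diagE. Qed.

(** [weak_derivative] is a choice that is specified only when a weak derivative exists. *)
Lemma in_H1_weak_derivative (X : R -> 'cV[R]_n) : in_H1 X ->
  in_L2 (weak_derivative X) /\ is_weak_derivative X (weak_derivative X).
Proof.
move=> [_ [g g_deriv]].
exact: (@xgetPex _ _ [set g | in_L2 g /\ is_weak_derivative X g] (ex_intro _ g g_deriv)).
Qed.

Lemma in_L2_opA (X : R -> 'cV[R]_n) : in_H1 X -> in_L2 (opA Lambda X).
Proof.
move=> /in_H1_weak_derivative[Lg _] i.
have -> : (fun z => opA Lambda X z i 0) =
    (fun z => - Lambda i i * weak_derivative X z i 0).
  by apply/funext => z; rewrite opA_comp mulNr.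
exact: L2scalarZ (Lg i).
Qed.

Lemma in_L2_opN (y : R -> 'cV[R]_q) : in_L2 y -> in_L2 (opN N y).
Proof.
move=> Ly i.
have -> : (fun z => opN N y z i 0) = (fun z => \sum_j N i j * y z j 0).
  by apply/funext => z; rewrite /opN mxE.
by apply: L2scalar_sum => j; exact: (L2scalarZ (N i j) (Ly j)).
Qed.

(** The energy inequality of each component, summed with the weights p_i lambda_i; the
    boundary terms have the right sign by [boundary_dissipation]. *)
Lemma transport_dissipation (X : R -> 'cV[R]_n) :
  domA H B ubar K X ->
  2 * wip p mu X (opA Lambda X) <= - mu * wip (fun i => (Q i i)^-1 * Lambda i i) mu X X.
Proof.
move=> [XH1 [Y [cY YX] Y01]].
have [Lg wg] := in_H1_weak_derivative XH1; have [LX _] := XH1.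
have LA := in_L2_opA XH1.
rewrite !wip_sum//.
pose e i := int01 (fun z => expR (- mu * z) * (X z i 0 * weak_derivative X z i 0)).
have -> : \sum_i (Q i i)^-1 *
      int01 (fun z => expR (- mu * z) * (X z i 0 * opA Lambda X z i 0)) =
    - \sum_i (Q i i)^-1 * Lambda i i * e i.
  rewrite -sumrN; apply: eq_bigr => i _; rewrite -mulrA -mulrN; congr (_ * _).
  rewrite -mulNr -int01Z; last first.
    apply: integrable01M; first exact: continuous_weight.
    exact: (integrable01_L2 (LX i) (Lg i)).
  by apply: eq_int01 => z _; rewrite opA_comp; ring.
have energy i : (Y 1 i 0 ^+ 2 * expR (- mu) - Y 0 i 0 ^+ 2) / 2 +
    mu / 2 * int01 (fun z => expR (- mu * z) * (X z i 0 * X z i 0)) <= e i.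
  have -> : int01 (fun z => expR (- mu * z) * (X z i 0 * X z i 0)) =
      int01 (fun z => expR (- mu * z) * X z i 0 ^+ 2) by [].
  apply: (energy_inequality (Y := fun z => Y z i 0) mu (LX i) (Lg i)).
  - by move=> phi tphi; exact: wg.
  - move=> z; apply: (@continuous_comp _ _ _ _ (fun M : 'cV[R]_n => M i 0)).
      exact: cY.
    exact: coord_continuous.
  - by move: YX; apply: (@filterS _ _ (ae_filter_ringOfSetsType _)) => z YX Dz; rewrite YX.
have bd := boundary_dissipation Y01.
have pl0 i : 0 <= (Q i i)^-1 * Lambda i i.
  by apply: mulr_ge0; rewrite ?invr_ge0 ltW.
have sum_le : \sum_i (Q i i)^-1 * Lambda i i *
      ((Y 1 i 0 ^+ 2 * expR (- mu) - Y 0 i 0 ^+ 2) / 2 +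
      mu / 2 * int01 (fun z => expR (- mu * z) * (X z i 0 * X z i 0))) <=
    \sum_i (Q i i)^-1 * Lambda i i * e i.
  by apply: ler_sum => i _; exact: ler_wpM2l.
have split_sum : \sum_i (Q i i)^-1 * Lambda i i *
      ((Y 1 i 0 ^+ 2 * expR (- mu) - Y 0 i 0 ^+ 2) / 2 +
      mu / 2 * int01 (fun z => expR (- mu * z) * (X z i 0 * X z i 0))) =
    (expR (- mu) * (\sum_i (Q i i)^-1 * Lambda i i * Y 1 i 0 ^+ 2) -
      \sum_i (Q i i)^-1 * Lambda i i * Y 0 i 0 ^+ 2) / 2 +
    mu / 2 * \sum_i (Q i i)^-1 * Lambda i i *
      int01 (fun z => expR (- mu * z) * (X z i 0 * X z i 0)).
  rewrite mulr_sumr -sumrB mulr_suml mulr_sumr -big_split/=.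
  by apply: eq_bigr => i _; ring.
move: sum_le bd; rewrite split_sum.
set s1 := \sum_i _; set s2 := \sum_i _; set s3 := \sum_i _; set s4 := \sum_i _; lra.
Qed.

(** The bound of [supply_rate] holds at each z, is multiplied by e^(-mu z) and integrated;
    its mu-term cancels the one left by transport, and e^(-mu z) <= 1 is used for y. *)
Lemma energy_dissipation (X : R -> 'cV[R]_n) (y : R -> 'cV[R]_q) :
  domA H B ubar K X -> in_L2 y ->
  2 * wip p mu X (opA Lambda X + opN N y) <=
  - alpha * wip p mu X X + L2norm y ^+ 2.
Proof.
move=> dX Ly; have [XH1 _] := dX; have [LX _] := XH1.
have LA := in_L2_opA XH1; have LN := in_L2_opN Ly.
rewrite wipDr// mulrDr.
have tr := transport_dissipation dX.
have : 2 * wip p mu X (opN N y) <=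
    mu * wip (fun i => (Q i i)^-1 * Lambda i i) mu X X - alpha * wip p mu X X +
    wip (fun=> 1) mu y y.
  rewrite -!int01Z; [|exact: integrable_wip..].
  rewrite -int01B; [|exact/integrable01Z/integrable_wip..].
  rewrite -int01D; [|apply: integrable01B; exact/integrable01Z/integrable_wip|
    exact: integrable_wip].
  apply: le_int01.
  - exact/integrable01Z/integrable_wip.
  - apply: integrable01D; last exact: integrable_wip.
    by apply: integrable01B; exact/integrable01Z/integrable_wip.
  - move=> z _; rewrite mulrCA !(mulrCA _ (expR _)) -mulrBr -mulrDr.
    rewrite ler_wpM2l ?expR_ge0//.
    apply: le_trans (supply_rate (X z) (y z)) _; rewrite lerD2l.
    by apply: ler_sum => j _; rewrite mul1r expr2.
have : wip (fun=> 1) mu y y <= 1 * L2norm y ^+ 2.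
  by apply: wip_le_L2norm => // i; rewrite ler01 lexx.
lra.
Qed.

End linear_matrix_inequalities.

(** * Lower integrals and strong measurability *)

Section lower_integral.
Context d (T : measurableType d) (R : realType) (nu : {measure set T -> \bar R}).
Local Open Scope ereal_scope.

(** The integral of a nonnegative function is a supremum over the simple functions below
    it, hence monotone without any measurability. *)
Lemma ge0_le_integral_nonmeasurable (D : set T) (f g : T -> \bar R) :
  (forall x, D x -> 0 <= f x) -> (forall x, D x -> f x <= g x) ->
  \int[nu]_(x in D) f x <= \int[nu]_(x in D) g x.
Proof.
move=> f0 fg; rewrite !ge0_integralE//; last first.
  by move=> x Dx; apply: le_trans (f0 _ Dx) (fg _ Dx).
apply: le_ereal_sup => _ [h /= hf <-]; exists h => //= x.
apply: le_trans (hf x) _; rewrite /patch; case: ifPn => // xD.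
by apply: fg; rewrite inE in xD.
Qed.

End lower_integral.

Section strong_measurability.
Context {R : realType} {k : nat}.
Local Notation leb := (@lebesgue_measure R).
Implicit Types (X : R -> R -> 'cV[R]_k) (v : R -> 'cV[R]_k).

Lemma in_L2_0 : in_L2 (0 : R -> 'cV[R]_k).
Proof.
move=> i; have -> : (fun z => (0 : R -> 'cV[R]_k) z i 0) = (fun=> 0).
  by apply/funext => z; rewrite mxE.
exact: L2scalar0.
Qed.

Lemma in_L2_comb n (a : 'I_n -> R) (v : 'I_n -> R -> 'cV[R]_k) :
  (forall j, in_L2 (v j)) -> in_L2 (\sum_j a j *: v j).
Proof.
by move=> Lv; elim/big_ind : _ => [|f g Lf Lg|j _];
  [exact: in_L2_0|exact: in_L2D|exact: in_L2Z].
Qed.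

Lemma wip_comb_l p mu n (a : 'I_n -> R) (v : 'I_n -> R -> 'cV[R]_k) g :
  (forall j, in_L2 (v j)) -> in_L2 g ->
  wip p mu (\sum_j a j *: v j) g = \sum_j a j * wip p mu (v j) g.
Proof.
move=> Lv Lg.
have H (s : seq 'I_n) : in_L2 (\sum_(j <- s) a j *: v j) /\
    wip p mu (\sum_(j <- s) a j *: v j) g = \sum_(j <- s) a j * wip p mu (v j) g.
  elim: s => [|j s [IH1 IH2]].
    rewrite !big_nil; split; first exact: in_L2_0.
    by rewrite -(scale0r 0) wipZl ?mul0r//; exact: in_L2_0.
  rewrite !big_cons; split; first exact: in_L2D (in_L2Z _ (Lv _)) IH1.
  by rewrite wipDl ?wipZl ?IH2//; exact: in_L2Z.
exact: (H _).2.
Qed.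

(** Expanding the square of the norm gives a combination of products of indicators. *)
Lemma simple_L2norm_measurable (s : R -> R -> 'cV[R]_k) : L2_simple s ->
  measurable_fun (setT : set (measurableTypeR R)) (fun t => L2norm (s t)).
Proof.
move=> [n [A [v [mA Lv sE]]]].
have -> : (fun t => L2norm (s t)) = Num.sqrt \o (fun t =>
    \sum_i \sum_j \1_(A i) t * (\1_(A j) t * wip (fun=> 1) 0 (v i) (v j))).
  apply/funext => t; rewrite /= L2normE /wnorm sE; congr Num.sqrt.
  rewrite wip_comb_l//; last exact: in_L2_comb.
  apply: eq_bigr => i _; rewrite wipC wip_comb_l// mulr_sumr.
  by apply: eq_bigr => j _; rewrite wipC.
apply: measurableT_comp; first exact: continuous_measurable_fun (@sqrt_continuous R).
have m1 i : measurable_fun (setT : set (measurableTypeR R)) (\1_(A i) : R -> R).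
  exact: (@measurable_indic _ (measurableTypeR R) R setT (A i) (mA i)).
apply: measurable_sum => i; apply: measurable_sum => j.
by apply: measurable_funM => //; exact: measurable_funM.
Qed.

Lemma simple_in_L2 (s : R -> R -> 'cV[R]_k) t : L2_simple s -> in_L2 (s t).
Proof. by move=> [n [A [v [mA Lv ->]]]]; exact: in_L2_comb. Qed.

(** The upper limit of the norms of the approximating simple functions is Borel and equals
    the norm of X off a null set; setting it to zero on a Borel null set that contains
    the exceptions turns it into a minorant everywhere on I. *)
Lemma strongly_measurable_L2norm (I : set R) X : (forall t, I t -> in_L2 (X t)) ->
  L2_strongly_measurable I X ->
  exists F : R -> R, [/\ measurable_fun (setT : set (measurableTypeR R)) F,
    forall t, 0 <= F t, forall t, I t -> F t <= L2norm (X t) &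
    \forall t \ae leb, I t -> F t = L2norm (X t)].
Proof.
move=> LX [s [s_simple [Z [mZ Z0 sX]]]].
pose G (t : R) : R := fine (limn_esup (fun j => (L2norm (s j t))%:E)).
have GE t : I t -> ~ Z t -> G t = L2norm (X t).
  move=> It Zt; have sXt : L2norm (s j t - X t) @[j --> \oo] --> 0.
    by apply: contrapT => H; apply: Zt; apply: sX => /= /(_ It).
  have cv : (L2norm (s j t))%:E @[j --> \oo] --> (L2norm (X t))%:E.
    apply: cvg_EFin; first by near=> j.
    apply/cvgrPdist_le => e e0; have /cvgrPdist_le/(_ e e0) := sXt.
    apply: filterS => j; rewrite sub0r normrN (ger0_norm (L2norm_ge0 _)).
    apply: le_trans; rewrite distrC; apply: L2norm_dist_le; last exact: LX.
    exact: simple_in_L2.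
  by rewrite /G (cvg_limn_einf_sup cv).2.
have mG : measurable_fun (setT : set (measurableTypeR R)) G.
  apply: (@measurableT_comp _ _ _ _ _ _ fine); first exact: fine_measurable.
  apply: measurable_fun_limn_esup => j; apply/measurable_EFinP.
  exact: simple_L2norm_measurable.
exists (fun t => Num.max (G t) 0 * \1_(~` Z) t); split.
- apply: measurable_funM; last by apply: measurable_indic; exact: measurableC.
  by apply: measurable_maxr.
- by move=> t; rewrite mulr_ge0// le_max lexx orbT.
- move=> t It; rewrite indicE; have [Zt|Zt] := pselect (Z t).
    by rewrite memNset ?mulr0 ?L2norm_ge0//= => /(_ Zt).
  by rewrite mem_set// mulr1 GE// max_l ?L2norm_ge0.
- exists Z; split => // t /=; apply: contra_notP => Zt It.
  by rewrite indicE mem_set// mulr1 GE// max_l ?L2norm_ge0.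
Unshelve. all: by end_near. Qed.

(** Neither g nor G need be Borel, so their lower integrals do not add up. By hypothesis
    g has a Borel version F, and then max (c - F, 0) / K, set to zero on the exceptional
    null set, is a Borel minorant h of G with c <= F + K h almost everywhere. Additivity
    is used for F and h, and only monotonicity for G. *)
Lemma le_interval_lower_integral (a b c K : R) (F G g : R -> R) : a <= b -> 0 < K ->
  measurable_fun (setT : set (measurableTypeR R)) F -> (forall t, 0 <= F t) ->
  (forall t, a <= t <= b -> 0 <= G t) ->
  (\forall t \ae leb, a <= t <= b -> F t = g t) ->
  (forall t, a <= t <= b -> c <= g t + K * G t) ->
  ((c * (b - a))%:E <= \int[leb]_(t in `[a, b]) (F t)%:E +
    K%:E * \int[leb]_(t in `[a, b]) (G t)%:E)%E.
Proof.
move=> ab K0 mF F0 G0 [Z [mZ Z0 FgZ]] cgG.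
have Fg t : a <= t <= b -> ~ Z t -> F t = g t.
  by move=> abt Zt; apply: contrapT => H; apply: Zt; apply: FgZ => /= /(_ abt).
pose h t : R := K^-1 * Num.max (c - F t) 0 * \1_(~` Z) t.
have mab : measurable (`[a, b]%classic : set (measurableTypeR R)) by exact: measurable_itv.
have mh : measurable_fun (setT : set (measurableTypeR R)) h.
  apply: measurable_funM; last by apply: measurable_indic; exact: measurableC.
  by apply: measurable_funM => //; apply: measurable_maxr => //; exact: measurable_funB.
have h0 t : 0 <= h t.
  by rewrite mulr_ge0// mulr_ge0 ?invr_ge0 ?(ltW K0)// le_max lexx orbT.
have hG : (\int[leb]_(t in `[a, b]) (h t)%:E <= \int[leb]_(t in `[a, b]) (G t)%:E)%E.
  apply: ge0_le_integral_nonmeasurable => t; rewrite /= in_itv/= => abt; rewrite lee_fin//.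
  rewrite /h indicE; have [Zt|Zt] := pselect (Z t).
    by rewrite memNset ?mulr0 ?G0//= => /(_ Zt).
  rewrite mem_set// mulr1 ler_pdivrMl// ge_max mulr_ge0 ?G0 ?(ltW K0)// andbT.
  by rewrite lerBlDl (Fg t)//; exact: cgG.
have K0' : (0%R <= K%:E)%E by rewrite lee_fin ltW.
apply: le_trans (leeD2l _ (lee_wpmul2l K0' hG)).
have [c0|c0] := leP 0 c; last first.
  apply: (@le_trans _ _ 0%E); first by rewrite lee_fin; nra.
  by apply: adde_ge0; [|apply: mule_ge0 => //]; apply: integral_ge0 => t _; rewrite lee_fin.
have -> : (c * (b - a))%:E = (\int[leb]_(t in `[a, b]) (c)%:E)%E.
  have lab : (leb `[a, b]%classic = (b - a)%:E)%E.
    rewrite lebesgue_measure_itv/= lte_fin -EFinB.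
    have [//|ba] := ltP a b; suff -> : b = a by rewrite subrr.
    by apply/eqP; rewrite eq_le ab ba.
  by rewrite EFinM -lab; symmetry; exact: integral_cst.
have mh' : measurable_fun (`[a, b]%classic : set (measurableTypeR R)) (fun t => (h t)%:E).
  by apply/measurable_EFinP; apply: measurable_funTS.
have mF' : measurable_fun (`[a, b]%classic : set (measurableTypeR R)) (fun t => (F t)%:E).
  by apply/measurable_EFinP; apply: measurable_funTS.
rewrite -ge0_integralZl//; last by move=> t _; rewrite lee_fin.
rewrite -ge0_integralD//; last 3 first.
- by move=> t _; rewrite lee_fin.
- by move=> t _; rewrite mule_ge0 ?lee_fin.
- exact: measurable_funeM.
apply: ae_ge0_le_integral => //.
- by move=> t _; rewrite adde_ge0 ?mule_ge0 ?lee_fin.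
- by apply: emeasurable_funD => //; exact: measurable_funeM.
- exists Z; split => // t /=; apply: contra_notP => Zt _.
  rewrite -EFinM -EFinD lee_fin /h indicE mem_set// mulr1 mulrA mulfV ?gt_eqF// mul1r.
  by rewrite -lerBlDl le_max lexx.
Qed.

End strong_measurability.

(** * Discrete Gronwall inequality *)

Section discrete_gronwall.
Context {R : realType}.

(** From 1 - y <= exp (- y) at y = alpha h / (1 + alpha h). The rate
    alpha / (1 + alpha e) does not depend on h <= e, so that these factors multiply
    to a single exponential, and it tends to alpha with e. *)
Lemma inv_expR_bound (alpha h e : R) : 0 < alpha -> 0 <= h -> h <= e ->
  (1 + alpha * h)^-1 <= expR (- (alpha / (1 + alpha * e)) * h).
Proof.
move=> a0 h0 he; have ah : 0 <= alpha * h by rewrite mulr_ge0// ltW.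
have d0 : 0 < 1 + alpha * h by lra.
have aeh : alpha * h <= alpha * e by rewrite ler_wpM2l// ltW.
apply: (@le_trans _ _ (expR (- (alpha * h / (1 + alpha * h))))).
  apply: le_trans (expR_ge1Dx _).
  by rewrite le_eqVlt; apply/orP; left; apply/eqP; field; rewrite gt_eqF.
rewrite ler_expR mulNr lerN2 mulrAC ler_wpM2l// lef_pV2 ?posrE//; lra.
Qed.

(** The increments of J and the errors K e_i are simply not damped, because the factor
    1 / (1 + alpha h) is at most one. *)
Lemma discrete_gronwall (alpha eps K : R) (V J e t : nat -> R) (M : nat) :
  0 < alpha -> 0 <= K -> 0 <= V 0%N -> t 0%N = 0 ->
  (forall i, (i < M)%N -> 0 < t i.+1 - t i < eps) ->
  (forall i, (i < M)%N -> 0 <= J i.+1 - J i) ->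
  (forall i, (i < M)%N -> 0 <= e i) ->
  (forall i, (i < M)%N ->
    (1 + alpha * (t i.+1 - t i)) * V i.+1 <= V i + (J i.+1 - J i) + K * e i) ->
  forall i, (i <= M)%N ->
  V i <= expR (- (alpha / (1 + alpha * eps)) * t i) * V 0%N + (J i - J 0%N) +
    K * \sum_(0 <= j < i) e j.
Proof.
move=> a0 K0 V0 t0 ht hJ he hV; elim=> [_|i IH iM].
  by rewrite t0 mulr0 expR0 mul1r subrr addr0 big_geq// mulr0 addr0.
have {IH} := IH (ltnW iM).
have /andP[h0 h1] := ht _ iM; have := hV _ iM; have J0 := hJ _ iM; have e0 := he _ iM.
have inv_le := inv_expR_bound a0 (ltW h0) (ltW h1).
set h := t i.+1 - t i in h0 h1 inv_le *.
have ah : 0 < 1 + alpha * h by rewrite ltr_wpDr// mulr_ge0// ltW.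
have inv1 : (1 + alpha * h)^-1 <= 1 by rewrite invf_le1// lerDl mulr_ge0// ltW.
rewrite -ler_pdivlMl// => step IH; apply: le_trans step _.
rewrite big_nat_recr//= (mulrDr K).
have Ji : 0 <= J i - J 0%N.
  have : forall k, (k <= i)%N -> 0 <= J k - J 0%N.
    elim=> [_|k IHk ki]; first by rewrite subrr.
    have := IHk (ltnW ki); have := hJ k (ltn_trans ki iM); lra.
  exact.
have Si : 0 <= \sum_(0 <= j < i) e j.
  by rewrite big_nat_cond sumr_ge0// => j /andP[/andP[_ ji] _]; rewrite he// (ltn_trans ji).
move: IH; set S := \sum_(_ <= _ < _) _ in Si *; set b := alpha / _ in inv_le *.
have -> : - b * t i.+1 = - b * h + - b * t i by rewrite /h; ring.
rewrite expRD; set E := expR (- b * t i) => IH.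
have E0 : 0 <= E := expR_ge0 _.
apply: (@le_trans _ _ ((1 + alpha * h)^-1 * (E * V 0%N + (J i.+1 - J 0%N + K * S + K * e i)))).
  by apply: ler_wpM2l; [rewrite invr_ge0 ltW|lra].
rewrite mulrDr.
apply: (@le_trans _ _ (expR (- b * h) * (E * V 0%N) + 1 * (J i.+1 - J 0%N + K * S + K * e i))).
  apply: lerD; first by rewrite ler_wpM2r// mulr_ge0.
  have Ke : 0 <= K * e i by rewrite mulr_ge0.
  have KS : 0 <= K * S by rewrite mulr_ge0.
  by apply: ler_wpM2r => //; lra.
by rewrite mulrA mul1r; lra.
Qed.

End discrete_gronwall.

(** * Energy of approximate and mild solutions *)

Section approximate_solutions.
Context {R : realType} {n m q : nat}.
Local Notation leb := (@lebesgue_measure R).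
Variables (Lambda H : 'M[R]_n) (B : 'M[R]_(n, m)) (N : 'M[R]_(n, q)).
Variables (ubar : 'I_m -> R) (K : 'M[R]_(m, n)).
Variables (p : 'I_n -> R) (mu alpha k : R).
Hypothesis Lambda_diag : is_diag_mx Lambda.
Hypothesis p_ge0 : forall i, 0 <= p i.
Hypothesis alpha_gt0 : 0 < alpha.
Hypothesis k_gt0 : 0 < k.
Hypothesis wnorm_le : forall f : R -> 'cV[R]_n, in_L2 f -> wnorm p mu f <= k * L2norm f.
Hypothesis dissipation : forall X (y : R -> 'cV[R]_q),
  domA H B ubar K X -> in_L2 y ->
  2 * wip p mu X (opA Lambda X + opN N y) <=
  - alpha * wip p mu X X + L2norm y ^+ 2.

Local Notation V f := (wip p mu f f).

Lemma domA_L2 (X : R -> 'cV[R]_n) : domA H B ubar K X -> in_L2 X.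
Proof. by case=> -[]. Qed.

(** The convexity of V, the dissipation inequality for y, and Cauchy-Schwarz for the
    defect f - N y. *)
Lemma implicit_step (X Xprev f : R -> 'cV[R]_n) (y : R -> 'cV[R]_q) (h C : R) :
  domA H B ubar K X -> in_L2 Xprev -> in_L2 f -> in_L2 y -> 0 < h ->
  wnorm p mu X <= C -> L2eq (h^-1 *: (X - Xprev)) (opA Lambda X + f) ->
  (V X - V Xprev) / h + alpha * V X <=
  L2norm y ^+ 2 + 2 * C * k * L2norm (opN N y - f).
Proof.
move=> dX Lp Lf Ly h0 XC XE.
have LX := domA_L2 dX; have LA := in_L2_opA Lambda_diag dX.1; have LN := in_L2_opN N Ly.
have Ld := in_L2B LX Lp; have Lr := in_L2B LN Lf.
have convex : V X - V Xprev <= 2 * wip p mu X (X - Xprev).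
  have := wip_ge0 mu (X - Xprev) p_ge0.
  have -> : X - Xprev = 1 *: X + (-1) *: Xprev by rewrite scale1r scaleN1r.
  rewrite wip_add_sqr// scale1r scaleN1r wipBr//; lra.
have dE : wip p mu X (X - Xprev) / h = wip p mu X (opA Lambda X + f).
  by rewrite mulrC -wipZr//; apply: wip_ae => //; [exact: in_L2Z|exact: in_L2D].
have fE : opA Lambda X + f = (opA Lambda X + opN N y) + (f - opN N y).
  by rewrite addrACA subrr addr0.
have le1 : (V X - V Xprev) / h <= 2 * wip p mu X (opA Lambda X + f).
  by rewrite -dE mulrA ler_wpM2r// invr_ge0 ltW.
have := dissipation dX Ly.
have Lr' := in_L2B Lf LN.
have LAN := in_L2D LA LN.
move: le1; rewrite fE wipDr// => le1 le2.
have cs : wip p mu X (f - opN N y) <= C * (k * L2norm (opN N y - f)).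
  apply: le_trans (wip_cauchy_schwarz mu p_ge0 LX Lr') _.
  rewrite L2norm_distC; apply: ler_pM => //; [exact: wnorm_ge0..|exact: wnorm_le].
by lra.
Qed.

(** The index is the last grid point before t; the hypothesis on C bounds the weighted
    norms of the values of the scheme. Since the inequality of [implicit_step] holds with
    y = d(s) for every s in a step, it can be integrated over s, which replaces |d(s)|^2
    by an integral of F^2 and the defect by its share of the L^1 error. *)
Lemma approximate_energy (eps T C : R) (d : R -> R -> 'cV[R]_q) (X0 : R -> 'cV[R]_n)
    (M : nat) (ts : nat -> R) (fs ws : nat -> R -> 'cV[R]_n) (w : R -> R -> 'cV[R]_n)
    (F : R -> R) (t : R) :
  0 < eps -> 0 < C ->
  approximate_solution_on Lambda H B ubar K eps T (fun s => opN N (d s)) X0 M ts fs ws w ->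
  (forall s, 0 <= s <= T -> in_L2 (d s)) ->
  measurable_fun (setT : set (measurableTypeR R)) F -> (forall s, 0 <= F s) ->
  (\forall s \ae leb, 0 <= s <= T -> F s = L2norm (d s)) ->
  leb.-integrable `[0, t] (EFin \o (fun s => F s ^+ 2)) -> 0 <= t <= T ->
  (forall i, (i <= M)%N -> wnorm p mu (ws i) <= C) ->
  exists i, [/\ (i <= M)%N, 0 <= ts i <= t, t < ts i + eps &
    V (ws i) <= expR (- (alpha / (1 + alpha * eps)) * ts i) * V (ws 0%N) +
     \int[leb]_(s in `[0, t]) (F s ^+ 2) + 2 * C * k * eps].
Proof.
move=> eps0 C0 [M0 ts0 ts_step ts_end fs_L2 err _ _ ws0_L2 ws_dom ws_eq _] Ld mF F0 FE iF.
move=> /andP[t0 tT] wsC.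
have ts_incr i : (i < M)%N -> 0 < ts i.+1 - ts i < eps by move=> iM; exact: (ts_step i.+1).
have ts_mono i j : (i <= j)%N -> (j <= M)%N -> ts i <= ts j.
  move=> /subnK <-; elim: (j - i)%N => // l IH lM.
  by have := IH (ltnW lM); have /andP[] := ts_incr _ lM; rewrite addSn; lra.
have ts_ge0 i : (i <= M)%N -> 0 <= ts i by move=> iM; rewrite -ts0 ts_mono.
have [i0 [i0M ts_le ts_gt]] : exists i, [/\ (i <= M)%N, ts i <= t & t < ts i + eps].
  pose P i := (i <= M)%N && (ts i <= t).
  have exP : exists i, P i by exists 0%N; rewrite /P ts0.
  have ubP i : P i -> (i <= M)%N by case/andP.
  case: (ex_maxnP exP ubP) => i /andP[iM ti] imax; exists i; split => //.
  move: iM; rewrite leq_eqVlt => /predU1P[iM|iM].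
    by have /andP[] := ts_end; rewrite iM; lra.
  have : ~~ P i.+1 by apply/negP => /imax; rewrite ltnn.
  by rewrite /P iM/= -ltNge; have /andP[] := ts_incr _ iM; lra.
exists i0; split => //; first by rewrite ts_le ts_ge0.
pose J s := \int[leb]_(x in `[0, s]) (F x ^+ 2).
pose E i := (\int[leb]_(s in `[ts i, ts i.+1]) (L2norm (opN N (d s) - fs i.+1))%:E)%E.
have E_ge0 i : (0 <= E i)%E by apply: integral_ge0 => s _; rewrite lee_fin L2norm_ge0.
have sumE : (\sum_(0 <= i < M) E i < eps%:E)%E.
  by move: err; rewrite big_add1.
have sumE_le i : (i <= M)%N -> (\sum_(0 <= j < i) E j <= \sum_(0 <= j < M) E j)%E.
  move=> iM; rewrite (big_cat_nat (n := i) (p := M))//= leeDl//.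
  by apply: sume_ge0.
have E_fin i : (i < M)%N -> E i \is a fin_num.
  move=> iM; rewrite ge0_fin_numE//; apply: le_lt_trans (ltry eps).
  apply: le_trans (ltW sumE); apply: le_trans (sumE_le _ iM).
  by rewrite big_nat_recr//= leeDr// sume_ge0.
pose e i := fine (E i).
have e_sum : \sum_(0 <= i < i0) e i <= eps.
  rewrite -lee_fin -sumEFin; apply: le_trans (ltW sumE); apply: le_trans (sumE_le _ i0M).
  rewrite big_nat_cond [leRHS]big_nat_cond; apply: lee_sum => i /andP[/andP[_ ii0] _].
  by rewrite fineK// E_fin// (leq_trans ii0).
have ws_L2 i : (i <= M)%N -> in_L2 (ws i).
  by case: i => // i iM; apply: domA_L2; exact: ws_dom.
have iFs a b : 0 <= a -> b <= t -> leb.-integrable `[a, b] (EFin \o (fun s => F s ^+ 2)).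
  move=> a0 bt; apply: integrableS iF => // x /=; rewrite !in_itv/= => /andP[ax xb].
  by rewrite (le_trans a0 ax) (le_trans xb).
have Jdiff i : (i < i0)%N ->
    J (ts i.+1) - J (ts i) = \int[leb]_(s in `[ts i, ts i.+1]) (F s ^+ 2).
  move=> ii0; have iM := leq_trans ii0 i0M.
  have ti1 : ts i.+1 <= t by apply: le_trans ts_le; exact: ts_mono.
  have /andP[h0 _] := ts_incr _ iM.
  rewrite /J (@Rintegral_itvB _ _ (BLeft 0) (BRight (ts i.+1))); last 3 first.
  - exact: iFs.
  - by rewrite bnd_simp ts_ge0// ltnW.
  - by rewrite bnd_simp; lra.
  rewrite Rintegral_itv_obnd_cbnd//.
  apply: integrableS (iFs (ts i) (ts i.+1) (ts_ge0 _ (ltnW iM)) ti1) => //.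
  exact: subset_itv_oc_cc.
have mF2 : measurable_fun (setT : set (measurableTypeR R)) (fun s => F s ^+ 2).
  exact: measurable_funX.
have step i : (i < i0)%N -> (1 + alpha * (ts i.+1 - ts i)) * V (ws i.+1) <=
    V (ws i) + (J (ts i.+1) - J (ts i)) + 2 * C * k * e i.
  move=> ii0; have iM := leq_trans ii0 i0M.
  have /andP[h0 _] := ts_incr _ iM; set h := ts i.+1 - ts i in h0 *.
  have ti1 : ts i.+1 <= t by apply: le_trans ts_le; exact: ts_mono.
  have inT s : ts i <= s <= ts i.+1 -> 0 <= s <= T.
    move=> /andP[s0 s1]; rewrite (le_trans (ts_ge0 _ (ltnW iM)) s0)/=.
    by rewrite (le_trans s1)// (le_trans ti1).
  have Kpos : 0 < 2 * C * k by rewrite !mulr_gt0.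
  have F2E : \forall s \ae leb, ts i <= s <= ts i.+1 -> F s ^+ 2 = L2norm (d s) ^+ 2.
    move: FE; apply: (@filterS _ _ (ae_filter_ringOfSetsType _)) => s FE /inT sT.
    by rewrite FE.
  have rate s : ts i <= s <= ts i.+1 ->
      (V (ws i.+1) - V (ws i)) / h + alpha * V (ws i.+1) <=
      L2norm (d s) ^+ 2 + 2 * C * k * L2norm (opN N (d s) - fs i.+1).
    move=> /inT sT; apply: implicit_step => //.
    - exact: ws_dom.
    - exact: ws_L2 (ltnW iM).
    - exact: fs_L2.
    - exact: Ld.
    - exact: wsC.
    - exact: (ws_eq i.+1).
  have tii : ts i <= ts i.+1 by rewrite -subr_ge0 ltW.
  have := le_interval_lower_integral tii Kpos mF2 (fun s => sqr_ge0 (F s))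
    (fun s _ => L2norm_ge0 _) F2E rate.
  rewrite -/(E i) -(fineK (E_fin _ iM)) -/(e i).
  have <- : (J (ts i.+1) - J (ts i))%:E = (\int[leb]_(s in `[ts i, ts i.+1]) (F s ^+ 2)%:E)%E.
    rewrite Jdiff// /Rintegral fineK//; apply: integrable_fin_num => //.
    exact: iFs (ts_ge0 _ (ltnW iM)) ti1.
  rewrite -EFinM -EFinD lee_fin -/h mulrDl divfK ?gt_eqF//.
  by lra.
have Jmono i : (i < i0)%N -> 0 <= J (ts i.+1) - J (ts i).
  by move=> ii0; rewrite Jdiff//; apply: Rintegral_ge0 => s _; exact: sqr_ge0.
have e0 i : (i < i0)%N -> 0 <= e i by move=> _; exact: fine_ge0.
have K0 : 0 <= 2 * C * k by rewrite ltW// !mulr_gt0.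
have := @discrete_gronwall R alpha eps (2 * C * k) (fun i => V (ws i))
  (fun i => J (ts i)) e ts i0 alpha_gt0 K0 (wip_ge0 mu _ p_ge0) ts0
  (fun i ii0 => ts_incr i (leq_trans ii0 i0M)) Jmono e0 step i0 (leqnn _).
rewrite ts0; move=> /le_trans; apply; apply: lerD; last by rewrite ler_wpM2l.
rewrite lerD2l.
have -> : J 0 = 0 by rewrite /J set_itv1 Rintegral_set1.
rewrite subr0 /J.
have iJ := iFs 0 t (lexx _) (lexx _).
rewrite -subr_ge0 (@Rintegral_itvB _ _ (BLeft 0) (BRight t)) ?bnd_simp ?ts_ge0//.
by apply: Rintegral_ge0 => s _; exact: sqr_ge0.
Qed.

Lemma L2norm_bounded (I : set R) (X : R -> R -> 'cV[R]_n) (T : R) : 0 <= T ->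
  (forall s, 0 <= s <= T -> I s) -> L2_continuous I X ->
  exists2 C, 0 < C & forall s, 0 <= s <= T -> L2norm (X s) <= C.
Proof.
move=> T0 subI [LX cX].
have cN : {within `[0, T], continuous (fun s => L2norm (X s))}.
  apply/subspace_continuousP => s; rewrite /= in_itv/= => sT.
  apply/cvgrPdist_le => e e0; have /cvgrPdist_le/(_ e e0) := cX s (subI _ sT).
  rewrite !near_withinE; apply: filterS => x; rewrite sub0r normrN => Xx.
  rewrite /= in_itv/= => xT; have := Xx (subI _ xT).
  rewrite ger0_norm ?L2norm_ge0// => /(le_trans _); apply.
  by rewrite distrC; apply: L2norm_dist_le; apply: LX; exact: subI.
have [c cT cmax] := EVT_max T0 cN.
exists (L2norm (X c) + 1); first by rewrite ltr_wpDl// L2norm_ge0.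
move=> s sT; apply: le_trans (cmax s _) _; first by rewrite in_itv.
by rewrite lerDl.
Qed.

(** The values of the approximate solution are within eps of those of X, hence bounded
    uniformly in eps <= 1, which gives the constant C in front of the error. *)
Lemma mild_energy_eps (I : set R) (X : R -> R -> 'cV[R]_n) (d : R -> R -> 'cV[R]_q)
    (X0 : R -> 'cV[R]_n) (F : R -> R) (T t : R) :
  (forall s, 0 <= s <= T -> I s) -> L2_continuous I X -> in_L2 X0 ->
  mild_on Lambda H B N ubar K T X d X0 ->
  (forall s, 0 <= s <= T -> in_L2 (d s)) ->
  measurable_fun (setT : set (measurableTypeR R)) F -> (forall s, 0 <= F s) ->
  (\forall s \ae leb, 0 <= s <= T -> F s = L2norm (d s)) ->
  leb.-integrable `[0, t] (EFin \o (fun s => F s ^+ 2)) -> 0 <= t <= T ->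
  exists2 C, 0 < C & forall eps, 0 < eps <= 1 -> exists tau v,
    [/\ 0 <= tau <= t /\ t < tau + eps, in_L2 v, L2norm (X tau - v) <= eps &
    V v <= expR (- (alpha / (1 + alpha * eps)) * tau) * (wnorm p mu X0 + k * eps) ^+ 2 +
     \int[leb]_(s in `[0, t]) (F s ^+ 2) + C * eps].
Proof.
move=> subI cX LX0 mX Ld mF F0 FE iF /andP[t0 tT].
have [C0 C0_gt0 XC0] := L2norm_bounded (le_trans t0 tT) subI cX.
have [LX _] := cX.
pose C := k * (C0 + 1).
have C_gt0 : 0 < C by rewrite mulr_gt0// addr_gt0.
exists (2 * C * k); first by rewrite mulr_gt0// mulr_gt0.
move=> eps /andP[eps0 eps1].
have [tM [w [[M [ts [fs [ws [tsM sol]]]]] Xw]]] := mX eps eps0.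
have [M0 ts0 ts_step ts_end _ _ w0 wE ws0_L2 ws_dom _ init] := sol.
have ts_incr i : (i < M)%N -> ts i < ts i.+1.
  by move=> iM; have /andP[] := ts_step i.+1 iM; rewrite subr_gt0.
have ts_mono i j : (i <= j)%N -> (j <= M)%N -> ts i <= ts j.
  move=> /subnK <-; elim: (j - i)%N => // l IH lM.
  by apply: le_trans (IH (ltnW lM)) (ltW (ts_incr _ lM)).
have ts_in i : (i <= M)%N -> 0 <= ts i <= tM.
  by move=> iM; rewrite -ts0 -tsM !ts_mono.
have tMT : tM <= T by rewrite -tsM; have /andP[] := ts_end.
have inT i : (i <= M)%N -> 0 <= ts i <= T.
  by move=> /ts_in/andP[-> /le_trans ->].
have w_ts i : (i <= M)%N -> w (ts i) = ws i.
  case: i => [_|i iM]; first by rewrite ts0.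
  by apply: wE => //=; rewrite lexx andbT ts_incr.
have ws_L2 i : (i <= M)%N -> in_L2 (ws i).
  by case: i => // i iM; apply: domA_L2; exact: ws_dom.
have Xws i : (i <= M)%N -> L2norm (X (ts i) - ws i) <= eps.
  by move=> iM; rewrite -w_ts//; apply: Xw; exact: ts_in.
have wsC i : (i <= M)%N -> wnorm p mu (ws i) <= C.
  move=> iM; apply: le_trans (wnorm_le (ws_L2 _ iM)) _; rewrite ler_pM2l//.
  have LXi := LX _ (subI _ (inT _ iM)).
  have := L2norm_dist_le LXi (ws_L2 _ iM).
  by have := Xws _ iM; have := XC0 _ (inT _ iM); rewrite ler_norml => h1 h2 /andP[h3 h4]; lra.
have [|i [iM ti tie Vi]] := approximate_energy eps0 C_gt0 sol Ld mF F0 FE iF _ wsC.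
  by rewrite t0.
exists (ts i), (ws i); split => //; [exact: ws_L2|exact: Xws|].
apply: le_trans Vi _; rewrite !lerD2r ler_wpM2l ?expR_ge0//.
rewrite -(wnorm_sqr _ _ p_ge0) ler_sqr ?nnegrE ?addr_ge0 ?wnorm_ge0//; last first.
  by rewrite mulr_ge0// ltW.
have -> : ws 0%N = X0 + (ws 0%N - X0) by rewrite addrC subrK.
have Ldiff := in_L2B ws0_L2 LX0.
apply: le_trans (wnorm_triangle mu p_ge0 LX0 Ldiff) _; rewrite lerD2l.
by apply: le_trans (wnorm_le Ldiff) _; rewrite ler_pM2l.
Qed.

(** Apply [mild_energy_eps] with eps = 1 / (j + 1): the grid points tau_j tend to t, X is
    continuous there, and all the constants converge. The limit is taken in the norm of V
    because that is where the triangle inequality is available. *)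
Lemma mild_energy (I : set R) (X : R -> R -> 'cV[R]_n) (d : R -> R -> 'cV[R]_q)
    (X0 : R -> 'cV[R]_n) (F : R -> R) (T t : R) :
  (forall s, 0 <= s <= T -> I s) -> L2_continuous I X -> in_L2 X0 ->
  mild_on Lambda H B N ubar K T X d X0 ->
  (forall s, 0 <= s <= T -> in_L2 (d s)) ->
  measurable_fun (setT : set (measurableTypeR R)) F -> (forall s, 0 <= F s) ->
  (\forall s \ae leb, 0 <= s <= T -> F s = L2norm (d s)) ->
  leb.-integrable `[0, t] (EFin \o (fun s => F s ^+ 2)) -> 0 <= t <= T ->
  V (X t) <= expR (- alpha * t) * V X0 + \int[leb]_(s in `[0, t]) (F s ^+ 2).
Proof.
move=> subI cX LX0 mX Ld mF F0 FE iF tT.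
have [C C0 approx] := mild_energy_eps subI cX LX0 mX Ld mF F0 FE iF tT.
have [LX contX] := cX.
set J := \int[leb]_(s in `[0, t]) (F s ^+ 2) in approx *.
pose e (j : nat) : R := j.+1%:R^-1.
have e01 j : 0 < e j <= 1 by rewrite invr_gt0 ltr0n/= invf_le1 ?ler1n.
have e_cvg : e j @[j --> \oo] --> (0 : R) by exact: cvg_harmonic.
have /choice[tv tvP] : forall j, exists tv : R * (R -> 'cV[R]_n),
    [/\ 0 <= tv.1 <= t /\ t < tv.1 + e j, in_L2 tv.2, L2norm (X tv.1 - tv.2) <= e j &
    V tv.2 <= expR (- (alpha / (1 + alpha * e j)) * tv.1) * (wnorm p mu X0 + k * e j) ^+ 2 +
     J + C * e j].
  by move=> j; have [tau [v tvP]] := approx _ (e01 j); exists (tau, v).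
pose tau j := (tv j).1; pose v j := (tv j).2.
have tau_cvg : tau j @[j --> \oo] --> t.
  apply/cvgrPdist_lt => r r0; have /cvgrPdist_lt/(_ r r0) := e_cvg.
  apply: filterS => j; rewrite sub0r normrN => er.
  have [[/andP[_ tau1] tau2] _ _ _] := tvP j.
  rewrite ger0_norm ?subr_ge0//; have := ler_norm (e j); rewrite /tau; lra.
have It : I t by exact: subI.
have tauT j : 0 <= tau j <= T.
  have [[/andP[tau0 tau1] _] _ _ _] := tvP j.
  by rewrite tau0 (le_trans tau1)//; case/andP: tT.
have Xtau : L2norm (X (tau j) - X t) @[j --> \oo] --> (0 : R).
  have : tau j @[j --> \oo] --> within I (nbhs t).
    move=> P /tau_cvg [j0 _ j0P]; exists j0 => // j jj0.
    exact: (j0P j jj0) (subI _ (tauT j)).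
  move=> /(@cvg_comp _ _ _ tau (fun s => L2norm (X s - X t))); apply.
  exact: contX.
have bound j : wnorm p mu (X t) <= k * L2norm (X (tau j) - X t) + k * e j +
    Num.sqrt (expR (- (alpha / (1 + alpha * e j)) * tau j) *
      (wnorm p mu X0 + k * e j) ^+ 2 + J + C * e j).
  have [_ Lv Xv Vv] := tvP j.
  have LXt := LX _ It; have LXtau := LX _ (subI _ (tauT j)).
  have L1 := in_L2B LXt LXtau; have L2 := in_L2B LXtau Lv.
  have XtE : X t = (X t - X (tau j)) + (X (tau j) - v j) + v j.
    by rewrite addrA subrK subrK.
  rewrite {1}XtE.
  apply: le_trans (wnorm_triangle mu p_ge0 (in_L2D L1 L2) Lv) _; apply: lerD.
    apply: le_trans (wnorm_triangle mu p_ge0 L1 L2) _; apply: lerD.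
      apply: le_trans (wnorm_le L1) _.
      by rewrite L2norm_distC.
    by apply: le_trans (wnorm_le L2) _; rewrite ler_pM2l.
  by rewrite /wnorm ler_wsqrtr.
have lim : k * L2norm (X (tau j) - X t) + k * e j +
    Num.sqrt (expR (- (alpha / (1 + alpha * e j)) * tau j) *
      (wnorm p mu X0 + k * e j) ^+ 2 + J + C * e j) @[j --> \oo] -->
    k * 0 + k * 0 + Num.sqrt (expR (- (alpha / (1 + alpha * 0)) * t) *
      (wnorm p mu X0 + k * 0) ^+ 2 + J + C * 0).
  apply: cvgD; first by apply: cvgD; apply: cvgMr.
  apply: continuous_cvg; first exact: sqrt_continuous.
  apply: cvgD; last exact: cvgMr.
  apply: cvgD; last exact: cvg_cst.
  apply: cvgM.
    apply: continuous_cvg; first exact: continuous_expR.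
    apply: cvgM => //; apply: cvgN; apply: cvgMr; apply: cvgV.
      by rewrite mulr0 addr0 oner_eq0.
    by apply: cvgD; [exact: cvg_cst|exact: cvgMr].
  by apply: cvgM; (apply: cvgD; [exact: cvg_cst|exact: cvgMr]).
have : wnorm p mu (X t) <= Num.sqrt (expR (- alpha * t) * V X0 + J).
  have -> : Num.sqrt (expR (- alpha * t) * V X0 + J) =
      k * 0 + k * 0 + Num.sqrt (expR (- (alpha / (1 + alpha * 0)) * t) *
      (wnorm p mu X0 + k * 0) ^+ 2 + J + C * 0).
    by rewrite !mulr0 !addr0 add0r divr1 wnorm_sqr.
  exact: ler_cvg_to (cvg_cst _) lim (nearW _ bound).
have J0 : 0 <= J by apply: Rintegral_ge0 => s _; exact: sqr_ge0.
rewrite -ler_sqr ?nnegrE ?sqrtr_ge0 ?wnorm_ge0// wnorm_sqr// sqr_sqrtr//.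
by rewrite addr_ge0// mulr_ge0 ?expR_ge0 ?wip_ge0.
Qed.

End approximate_solutions.

(** * Spectrum of a diagonal matrix and the final constants *)

Section eigenvalues.
Context {R : realType} {k : nat}.
Implicit Types M : 'M[R]_k.

Lemma eigenvalue_diagP M a : is_diag_mx M -> eigenvalue M a <-> exists i, M i i = a.
Proof.
move=> /is_diag_mxP dM.
have mulE (v : 'rV[R]_k) j : (v *m M) 0 j = v 0 j * M j j.
  rewrite mxE (bigD1 j)//= big1 ?addr0// => s sj.
  by rewrite dM ?mulr0.
split=> [/eigenvalueP[v vM v0]|[i <-]].
  have [j vj] : exists j, v 0 j != 0.
    apply/existsP; apply: contraNT v0 => /existsPn v0; apply/eqP/rowP => j.
    by rewrite mxE; apply/eqP; have := v0 j; rewrite negbK.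
  exists j; have /rowP/(_ j) := vM; rewrite mulE mxE mulrC => /(mulIf vj).
  by [].
apply/eigenvalueP; exists (delta_mx 0 i).
  apply/rowP => j; rewrite mulE !mxE eqxx/=.
  by case: eqVneq => [->|_]; rewrite ?mulr0 ?mul0r// mul1r mulr1.
by apply/eqP => /rowP/(_ i); rewrite !mxE !eqxx => /eqP; rewrite oner_eq0.
Qed.

Lemma spectrum_bounds M i : is_diag_mx M -> lambda_min M <= M i i <= lambda_max M.
Proof.
move=> dM; have Mi : [set a | eigenvalue M a] (M i i).
  by apply/eigenvalue_diagP => //; exists i.
have bnd a : eigenvalue M a -> `|a| <= \sum_j `|M j j|.
  by move=> /(eigenvalue_diagP _ dM)[j <-]; rewrite (bigD1 j)//= lerDl sumr_ge0.
apply/andP; split.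
  apply: ge_inf => //; exists (- \sum_j `|M j j|) => a /bnd.
  by rewrite ler_norml => /andP[].
apply: ub_le_sup => //; exists (\sum_j `|M j j|) => a /bnd.
by apply: le_trans; exact: ler_norm.
Qed.

Lemma lambda_min_ge M c : (0 < k)%N -> is_diag_mx M -> (forall i, c <= M i i) ->
  c <= lambda_min M.
Proof.
move=> k0 dM cM; apply: lb_le_inf.
  by exists (M (Ordinal k0) (Ordinal k0)); apply/eigenvalue_diagP => //; eexists.
by move=> a /(eigenvalue_diagP _ dM)[i <-].
Qed.

(** lambda_max M and lambda_min (invmx M) are the extreme values of M i i and of their
    inverses. *)
Lemma inverse_spectrum M : (0 < k)%N -> is_diag_mx M -> posdef M ->
  [/\ 0 < lambda_max M, 0 < lambda_min (invmx M),
    (lambda_min (invmx M))^-1 <= lambda_max M &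
    forall i, lambda_min (invmx M) <= (M i i)^-1 <= lambda_max (invmx M)].
Proof.
move=> k0 dM pM; have M0 i : 0 < M i i := posdef_diag_gt0 i pM.
have [_ dV Vii] := invmx_diag dM (fun i => lt0r_neq0 (M0 i)).
have le_max i : M i i <= lambda_max M by have /andP[] := spectrum_bounds i dM.
have bounds i : lambda_min (invmx M) <= (M i i)^-1 <= lambda_max (invmx M).
  by rewrite -Vii; exact: spectrum_bounds.
have min_ge : (lambda_max M)^-1 <= lambda_min (invmx M).
  apply: lambda_min_ge => // i; rewrite Vii lef_pV2 ?posrE; first exact: le_max.
    exact: lt_le_trans (M0 i) (le_max i).
  exact: M0.
move: (lambda_max M) (lambda_min (invmx M)) le_max min_ge bounds => a b le_max min_ge bounds.
have a0 : 0 < a := lt_le_trans (M0 (Ordinal k0)) (le_max _).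
have b0 : 0 < b by apply: lt_le_trans min_ge; rewrite invr_gt0.
by split => //; rewrite -[a]invrK lef_pV2 ?posrE ?invr_gt0.
Qed.

End eigenvalues.

(** Divide by pmin e^(-mu), bound 1 / pmin by qmax in the term with r, and use a^2 + b^2 <= (a + b)^2 for a, b >= 0. *)
Lemma gain_estimate (R : realType) (alpha mu t pmax pmin qmax x x0 V V0 J r : R) :
  0 < pmin -> 0 < pmax -> 0 < qmax -> pmin^-1 <= qmax -> 0 <= x -> 0 <= x0 -> 0 <= r ->
  pmin * expR (- mu) * x ^+ 2 <= V -> V <= expR (- alpha * t) * V0 + J ->
  V0 <= pmax * x0 ^+ 2 -> J <= r ->
  x <= Num.sqrt (pmax / pmin) * expR (mu / 2) * expR (- (alpha / 2) * t) * x0 +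
    Num.sqrt qmax * expR (mu / 2) * Num.sqrt r.
Proof.
move=> pmin0 pmax0 qmax0 pq x_ge0 x0_ge0 r0 lo energy up J_le.
set A := _ * x0; set B := _ * Num.sqrt r.
have A0 : 0 <= A by rewrite !mulr_ge0 ?expR_ge0 ?sqrtr_ge0.
have B0 : 0 <= B by rewrite !mulr_ge0 ?expR_ge0 ?sqrtr_ge0.
rewrite -ler_sqr ?nnegrE ?addr_ge0//.
apply: (@le_trans _ _ (A ^+ 2 + B ^+ 2)); last first.
  by rewrite sqrrD lerD2r lerDl mulrn_wge0// mulr_ge0.
have c0 : 0 < pmin * expR (- mu) by rewrite mulr_gt0 ?expR_gt0.
have exp2 (y : R) : expR (y / 2) ^+ 2 = expR y by rewrite expr2 -expRD -splitr.
have -> : A ^+ 2 = (pmin * expR (- mu))^-1 * (expR (- alpha * t) * (pmax * x0 ^+ 2)).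
  rewrite /A !exprMn sqr_sqrtr ?divr_ge0 ?(ltW pmin0) ?(ltW pmax0)// exp2.
  have -> : - (alpha / 2) * t = (- alpha * t) / 2 by field.
  by rewrite exp2 expRN; field; rewrite !gt_eqF ?expR_gt0.
have B_ge : (pmin * expR (- mu))^-1 * r <= B ^+ 2.
  rewrite /B !exprMn !sqr_sqrtr ?(ltW qmax0)// exp2 ler_wpM2r// invfM expRN invrK.
  by rewrite ler_wpM2r ?expR_ge0.
apply: le_trans (lerD (lexx _) B_ge); rewrite -mulrDr ler_pdivlMl//.
apply: le_trans lo _; apply: le_trans energy _; apply: lerD => //.
by rewrite ler_wpM2l ?expR_ge0.
Qed.

Lemma L2norm_dim0 (R : realType) n (f : R -> 'cV[R]_n) : n = 0%N -> L2norm f = 0.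
Proof.
move=> n0; rewrite /L2norm (_ : Rintegral _ _ _ = 0) ?sqrtr0//.
transitivity (int01 (fun=> 0 : R)); last by rewrite /int01 Rintegral_cst// mul0r.
apply: eq_int01 => z _; rewrite big1// => i _.
by have := ltn_ord i; rewrite {2}n0.
Qed.

Theorem corollary1 (R : realType) (n m q : nat)
  (Lambda H : 'M[R]_n) (B : 'M[R]_(n, m)) (N : 'M[R]_(n, q)) (ubar : 'I_m -> R)
  (Lambda_diag : is_diag_mx Lambda) (Lambda_pos : posdef Lambda)
  (ubar_pos : forall i, 0 < ubar i)
  (Q : 'M[R]_n) (S : 'M[R]_m) (Gamma : 'M[R]_n) (mu alpha : R) (W : 'M[R]_(m, n))
  (Q_diag : is_diag_mx Q) (Q_pos : posdef Q)
  (S_diag : is_diag_mx S) (S_pos : posdef S)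
  (Gamma_pos : posdef Gamma) (mu_pos : 0 < mu) (alpha_pos : 0 < alpha)
  (LMI1 : negsemidef
    (block_mx
      (- (Q *m invmx Lambda))
      (row_mx (H *m Q + B *m W) (B *m S))
      (col_mx (H *m Q + B *m W)^T (B *m S)^T)
      (block_mx (- (expR (- mu) *: (Lambda *m Q))) (- W^T)
                (- W) (- (2 *: S)))))
  (LMI2 : possemidef (block_mx Gamma N N^T 1%:M))
  (LMI3 : negsemidef (Q *m (alpha%:M - mu *: Lambda) + Gamma)) :
  let K : 'M[R]_(m, n) := W *m invmx Q in
  let P : 'M[R]_n := invmx Q in
  let omega : R := alpha / 2 in
  let kappa : R := Num.sqrt (lambda_max P / lambda_min P) * expR (mu / 2) in
  let gamma : R := Num.sqrt (lambda_max Q) * expR (mu / 2) in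
  forall (I : set R) (X : R -> R -> 'cV[R]_n) (d : R -> R -> 'cV[R]_q)
    (X0 : R -> 'cV[R]_n),
  mild_solution_pair Lambda H B N ubar K I X d X0 ->
  forall t, I t ->
  ((L2norm (X t))%:E <=
    (kappa * expR (- omega * t) * L2norm X0)%:E +
    gamma%:E * sqrte (\int[@lebesgue_measure R]_(theta in `[0%R, t])
                        ((L2norm (d theta)) ^+ 2)%:E))%E.
Proof.
move=> K P omega kappa gamma I X d X0 [cX [Ld dmeas _] LX0 _ sol] t It.
set D := (X in sqrte X).
have D0 : (0 <= D)%E by apply: integral_ge0 => s _; rewrite lee_fin sqr_ge0.
have kappa0 : 0 <= kappa by rewrite mulr_ge0 ?sqrtr_ge0 ?expR_ge0.
have gamma0 : 0 <= gamma by rewrite mulr_ge0 ?sqrtr_ge0 ?expR_ge0.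
(* In dimension zero the spectra are empty and the extreme eigenvalues meaningless. *)
have [n0|n_gt0] := posnP n.
  rewrite L2norm_dim0//; apply: adde_ge0; first by rewrite lee_fin !mulr_ge0 ?expR_ge0 ?L2norm_ge0.
  by apply: mule_ge0; rewrite ?lee_fin// sqrte_ge0.
have [lmaxQ0 lminP0 lminP_le bounds] := inverse_spectrum n_gt0 Q_diag Q_pos.
have lmaxP0 : 0 < lambda_max P.
  have /andP[lo hi] := bounds (Ordinal n_gt0).
  exact: lt_le_trans lminP0 (le_trans lo hi).
have gamma_gt0 : 0 < gamma by apply: mulr_gt0; [rewrite sqrtr_gt0|exact: expR_gt0].
(* The bound is infinite when the energy of d is. *)
have [Dy|] := eqVneq D +oo%E.
  by rewrite Dy /= gt0_muley ?lte_fin// addey ?leey.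
rewrite -ltey -ge0_fin_numE// => D_fin.
have [F [mF F0 F_le F_eq]] := strongly_measurable_L2norm Ld dmeas.
have [T [subI /andP[t0 tT] mX]] : exists T, [/\ forall s, 0 <= s <= T -> I s,
    0 <= t <= T & mild_on Lambda H B N ubar K T X d X0].
  case: sol => [[T [_ IE mX]]|[IE mX]].
    exists T; split => //; last by move: It; rewrite IE/= in_itv.
    by move=> s; rewrite IE/= in_itv.
  have t0 : 0 <= t by move: It; rewrite IE/= in_itv/= andbT.
  exists (t + 1); split; last by apply: mX; rewrite ltr_wpDl.
    by move=> s /andP[s0 _]; rewrite IE/= in_itv/= s0.
  by rewrite t0/= lerDl.
have F2_le : (\int[@lebesgue_measure R]_(s in `[0%R, t]) (F s ^+ 2)%:E <= D)%E.
  apply: ge0_le_integral_nonmeasurable => s; rewrite /= in_itv/= => /andP[s0 st].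
    by rewrite lee_fin sqr_ge0.
  rewrite lee_fin ler_sqr ?nnegrE ?L2norm_ge0//; apply/F_le/subI.
  by rewrite s0 (le_trans st).
have iF : (@lebesgue_measure R).-integrable `[0, t] (EFin \o (fun s => F s ^+ 2)).
  apply/integrableP; split.
    by apply/measurable_EFinP; apply: measurable_funTS; exact: measurable_funX.
  apply: le_lt_trans (_ : D < +oo)%E; last by rewrite -ge0_fin_numE.
  apply: le_trans F2_le; rewrite le_eqVlt; apply/orP; left; apply/eqP.
  by apply: eq_integral => s _; rewrite /= ger0_norm ?sqr_ge0.
have p0 i : 0 <= (Q i i)^-1 by rewrite invr_ge0 ltW// posdef_diag_gt0.
have p_le i : 0 <= (Q i i)^-1 <= lambda_max P by rewrite p0; have /andP[] := bounds i.
have mu0 := ltW mu_pos.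
have wle (f : R -> 'cV[R]_n) : in_L2 f ->
    wnorm (fun i => (Q i i)^-1) mu f <= Num.sqrt (lambda_max P) * L2norm f.
  move=> Lf; rewrite -ler_sqr ?nnegrE ?wnorm_ge0 ?mulr_ge0 ?sqrtr_ge0 ?L2norm_ge0//.
  by rewrite wnorm_sqr// exprMn sqr_sqrtr ?(ltW lmaxP0)// wip_le_L2norm.
have k0 : 0 < Num.sqrt (lambda_max P) by rewrite sqrtr_gt0.
have energy := mild_energy Lambda_diag p0 alpha_pos k0 wle
  (energy_dissipation Lambda_diag Lambda_pos ubar_pos Q_diag Q_pos S_diag S_pos mu0 LMI1 LMI2 LMI3)
  subI cX LX0 mX.
have F_eqT : \forall s \ae @lebesgue_measure R, 0 <= s <= T -> F s = L2norm (d s).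
  move: F_eq; apply: (@filterS _ _ (ae_filter_ringOfSetsType _)) => s Fs /subI Is.
  exact: Fs.
have t0T : 0 <= t <= T by rewrite t0.
have {energy} := energy F t (fun s sT => Ld s (subI _ sT)) mF F0 F_eqT iF t0T.
set J := \int[_]_(s in _) _ => energy.
pose r := fine D; have r0 : 0 <= r by exact: fine_ge0.
have J_le : J <= r.
  rewrite -lee_fin /r (fineK D_fin) /J /Rintegral fineK//.
  exact: integrable_fin_num.
have LXt : in_L2 (X t) by apply: cX.1.
have lo : lambda_min P * expR (- mu) * L2norm (X t) ^+ 2 <=
    wip (fun i => (Q i i)^-1) mu (X t) (X t).
  by apply: wip_ge_L2norm => // [|i]; [exact: ltW|have /andP[] := bounds i].
have up := wip_le_L2norm mu0 p_le LX0.
rewrite -(fineK D_fin) -/r /sqrte -EFinM -EFinD lee_fin.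
exact: gain_estimate lminP0 lmaxP0 lmaxQ0 lminP_le (L2norm_ge0 _) (L2norm_ge0 _) r0
  lo energy up J_le.
Qed.
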